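(* Let $H$ be a tree with a vertex ordering $\theta$, and fix a limb weight sequence $\Lambda$ and a limb degree sequence $\Delta$ relative to $\theta$. Among all trees with core $H$, limb weight sequence $\Lambda$, and limb degree sequence $\Delta$ (both relative to $\theta$), the locally balanced tree is optimal.
   Context: The order of a graph is its number of vertices. A subtree of a tree $T$ is a nonempty connected subgraph. The mean subtree order $M_T$ is the average of the orders of all subtrees of $T$. A tree of maximum mean subtree order in a given family is called optimal in that family. Let $T$ be a tree that is not a path. A limb of $T$ is a maximal path in $T$ containing a leaf of $T$ and no vertices of degree greater than $2$ in $T$. The core $c(T)$ is the tree obtained from $T$ by deleting all limbs of $T$. A limb $L$ is adjacent to a vertex $v$ of $c(T)$ if an end vertex of $L$ is adjacent to $v$ in $T$. For a vertex $v$ of $c(T)$, the limb degree $\deg_\lambda(v)$ is the number of limbs adjacent to $v$, and the limb weight $w_\lambda(v)$ is the total order (total number of vertices) of the limbs adjacent to $v$. For an ordering $\theta: v_1,\dots,v_c$ of the vertices of $H=c(T)$, the limb degree sequence of $T$ relative to $\theta$ is $(\deg_\lambda(v_1),\dots,\deg_\lambda(v_c))$ and the limb weight sequence of $T$ relative to $\theta$ is $(w_\lambda(v_1),\dots,w_\lambda(v_c))$. The tree $T$ is locally balanced if for each vertex $v$ of $c(T)$, the limbs adjacent to $v$ pairwise differ in order by at most $1$. A locally balanced tree with given core, limb degree sequence and limb weight sequence is unique up to isomorphism. The sequences $\Lambda,\Delta$ are understood to be realized by at least one tree with core $H$. *)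

(* Defs.v *)
From mathcomp Require Import all_boot all_order all_algebra.

Set Implicit Arguments.
Unset Strict Implicit.
Unset Printing Implicit Defensive.

Import Order.TTheory GRing.Theory Num.Theory.

Record sgraph := SGraph {
  vertex :> finType;
  edge : rel vertex;
  edge_sym : symmetric edge;
  edge_irr : irreflexive edge }.

Section Induced.
Variables (G : sgraph) (A : {set G}).

Definition induced_edge : rel {x : G | x \in A} :=
  fun x y => edge (val x) (val y).

Lemma induced_sym : symmetric induced_edge.
Proof. by move=> x y; apply: edge_sym. Qed.

Lemma induced_irr : irreflexive induced_edge.
Proof. by move=> x; apply: edge_irr. Qed.

Definition induced : sgraph := SGraph induced_sym induced_irr.

End Induced.

Definition graph_iso (G G' : sgraph) (f : G -> G') : Prop :=
  bijective f /\ {mono f : x y / edge x y}.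

Definition is_tree (G : sgraph) : Prop :=
  [/\ 0 < #|G|,
      forall x y : G, connect (@edge G) x y
    & forall c : seq G, 2 < size c -> ~ ucycle (@edge G) c].

(* A subgraph is a pair S of a vertex set S.1 and a set S.2 of edges, where an
   undirected edge is the set of its two end points.  It need not be induced. *)
Notation subgraph_data G := ({set G} * {set {set G}})%type.

Section Subgraphs.
Variable G : sgraph.

Definition edges_in (A : {set G}) : {set {set G}} :=
  [set [set x; y] | x in A, y in A & edge x y].

Definition whole : subgraph_data G := ([set: G], edges_in [set: G]).

Definition subgraph (S : subgraph_data G) : bool := S.2 \subset edges_in S.1.

Definition subedge (S : subgraph_data G) : rel G :=
  fun x y => [set x; y] \in S.2.

Definition sub_le (S S' : subgraph_data G) : bool :=
  (S.1 \subset S'.1) && (S.2 \subset S'.2).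

Definition subtree (S : subgraph_data G) : bool :=
  [&& subgraph S, S.1 != set0
    & [forall x in S.1, forall y in S.1, connect (subedge S) x y]].

Definition mean_subtree_order : rat :=
  ((\sum_(S | subtree S) #|S.1|)%N%:R / #|[set S | subtree S]|%:R)%R.

Definition walk_subgraph (u : G) (p : seq G) : subgraph_data G :=
  ([set x in u :: p], [set [set e.1; e.2] | e in zip (u :: p) p]).

(* P is a path having u as one of its two end vertices (both of them if P has a
   single vertex).  The bound on n is harmless: p has no repetitions. *)
Definition path_from (P : subgraph_data G) (u : G) : bool :=
  [exists n : 'I_#|G|, exists p : n.-tuple G,
     [&& path (@edge G) u p, uniq (u :: p) & P == walk_subgraph u p]].

Definition is_path (P : subgraph_data G) : bool := [exists u, path_from P u].

Definition degree (x : G) : nat := #|[set y | edge x y]|.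

Definition leaf (x : G) : bool := degree x == 1.

Definition limb_candidate (P : subgraph_data G) : bool :=
  [&& is_path P, [exists x in P.1, leaf x]
    & [forall x in P.1, degree x <= 2]].

Definition limb (L : subgraph_data G) : bool :=
  limb_candidate L &&
  [forall P, limb_candidate P && sub_le L P ==> (P == L)].

Definition core_set : {set G} := ~: \bigcup_(L | limb L) L.1.

Definition core : sgraph := induced core_set.

Definition limb_adjacent (L : subgraph_data G) (v : G) : bool :=
  [exists u, path_from L u && edge u v].

Definition limbs_at (v : G) : {set subgraph_data G} :=
  [set L | limb L && limb_adjacent L v].

Definition limb_degree (v : G) : nat := #|limbs_at v|.

Definition limb_weight (v : G) : nat := \sum_(L in limbs_at v) #|L.1|.

(* By symmetry in L and L' this bounds the difference of the two orders. *)
Definition locally_balanced : Prop :=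
  forall v, v \in core_set ->
  {in limbs_at v &, forall L L' : subgraph_data G, #|L.1| <= #|L'.1| + 1}.

End Subgraphs.

(* The identification of H with the core of T is an isomorphism f, and the two
   sequences of T are read off along the vertex ordering theta of H through f. *)
Definition limb_family (H : sgraph) (theta : seq H) (Lambda Delta : seq nat)
    (T : sgraph) : Prop :=
  [/\ is_tree T, ~~ is_path (whole T)
    & exists f : H -> core T,
      [/\ graph_iso f,
          [seq limb_weight (val (f v)) | v <- theta] = Lambda
        & [seq limb_degree (val (f v)) | v <- theta] = Delta]].

Definition optimal_in (F : sgraph -> Prop) (T : sgraph) : Prop :=
  F T /\ forall T', F T' -> (mean_subtree_order T' <= mean_subtree_order T)%R.

(* Main.v *)
Require Import Defs.
From mathcomp Require Import all_boot all_order all_algebra.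
From mathcomp Require Import ring lra zify.

Set Implicit Arguments.
Unset Strict Implicit.
Unset Printing Implicit Defensive.

(** Write H for the core of T.  A subtree of T that meets H cuts it in a
    connected set S and, over each vertex v of S and for each limb of order l at
    v, independently contains an initial segment of 0 to l vertices of that limb.
    The remaining subtrees are subpaths of single limbs.  Let P(S) be the product
    of the numbers l + 1 over all limbs at vertices of S, and a(S) the sum of
    1 + w(v) / 2 over v in S, where w is the limb weight: the average order of the
    P(S) subtrees with trace S is a(S).  Hence T has
      sum_S P(S) + sum_l l (l + 1) / 2
    subtrees, and the sum of their orders is
      sum_S P(S) a(S) + sum_l l (l + 1) (l + 2) / 6,
    with l running over all limb orders ([mean_order_formula]).  So the mean
    depends only on the multisets of limb orders at the vertices of H.

    Replace two limb orders x >= y + 2 at one vertex v by x - 1 and y + 1, and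
    put d = x - y - 1.  No a(S) changes.  The limbs lose d subpaths, of total order
    d (1 + (x + y) / 2), while P(S) is multiplied by 1 + d / ((x + 1) (y + 1)) for
    each S through v.  The subtrees gained have average order c, the mean order of
    the subtrees that contain v; they are at least d in number, and
    1 + (x + y) / 2 <= c.  So the move amounts to adding subtrees whose average
    order is at least c.  By a theorem of Jamison the local mean c is at least the
    global mean ([local_mean]), hence the move does not decrease the mean
    ([balance_step]).

    The moves stop when the orders at each vertex differ by at most 1, and such a
    list is determined up to order by its length and its sum
    ([balanced_perm]).  This gives the optimality of locally balanced trees
    ([balanced_optimal]).  To show that one exists, the w(v) limb vertices over v
    are numbered from 0 and vertex k is hung below vertex k - d(v), or below v
    itself if k < d(v), where d(v) is the limb degree: the limbs at v are then the
    residue classes modulo d(v).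

    Trees are handled throughout by rooting them.  In terms of the parent function
    a subtree is a set of vertices with a top, limbs are the maximal branches in
    which no vertex has two children, and the product formulas come from cutting
    sets of vertices along branches. *)

(** * Rooted trees *)

(** The rank only serves inductions towards the base: any function that decreases
    along [parent] will do. *)
Record rooting (G : sgraph) := Rooting {
  base : G;
  parent : G -> G;
  rank : G -> nat;
  parent_base : parent base = base;
  rank_parent : forall x, x != base -> rank (parent x) < rank x;
  edge_parent : forall x y, edge x y =
    ((x != base) && (parent x == y)) || ((y != base) && (parent y == x)) }.

Section TreeRooting.
Variables (G : sgraph) (r : G).
Hypothesis treeG : is_tree G.

Let avoid (x : G) : rel G := fun a b => [&& edge a b, a != x & b != x].
(** If y is a neighbour of x from which r can be reached avoiding x, then y is
    the parent of x; acyclicity makes it unique. *)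
Let toward (x y : G) := edge x y && connect (avoid x) y r.

Let path_avoid x a p : path (@edge G) a p -> x \notin a :: p -> path (avoid x) a p.
Proof.
elim: p a => //= b p IHp a /andP[ab bp] xabp.
rewrite IHp // ?andbT.
  by move: xabp; rewrite !inE !negb_or /avoid ab eq_sym => /and3P[-> ]; rewrite eq_sym => ->.
by move: xabp; rewrite !inE !negb_or => /andP[_].
Qed.

Let toward_uniq x y y' : toward x y -> toward x y' -> y = y'.
Proof.
move=> /andP[xy yr] /andP[xy' y'r].
have avC : connect_sym (avoid x).
  by apply: sym_connect_sym => a b; rewrite /avoid edge_sym [(_ != _) && _]andbC.
have /connectP[p0 yp0] : connect (avoid x) y y'.
  by apply: connect_trans yr _; rewrite avC.
case/shortenP: yp0 => p yp uniq_p _ {p0} y'E.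
case: p => [|z p] in yp uniq_p y'E; first by rewrite y'E.
(* Two distinct such neighbours y and y' close a cycle through x. *)
case: treeG => _ _ /(_ (x :: y :: z :: p) isT) [].
have pe a s : path (avoid x) a s -> path (@edge G) a s && (x \notin s).
  elim: s a => //= b s IHs a /andP[/and3P[ab _ bx] /IHs/andP[bs xs]].
  by rewrite ab bs inE negb_or eq_sym bx.
have /andP[ep xp] := pe _ _ yp.
rewrite /ucycle.
have -> : cycle (@edge G) (x :: y :: z :: p) =
  edge x y && path (@edge G) y (rcons (z :: p) x) by [].
rewrite xy rcons_path ep -y'E edge_sym xy' cons_uniq uniq_p andbT inE negb_or xp andbT.
by rewrite andbT; apply: contraTneq xy => ->; rewrite edge_irr.
Qed.

Let has_walk x n := [exists p : n.-tuple G, path (@edge G) x p && (last x p == r)].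

Let has_walkP x p : path (@edge G) x p -> last x p = r -> has_walk x (size p).
Proof. by move=> xp /eqP pr; apply/existsP; exists (in_tuple p); rewrite xp. Qed.

Let ex_walk x : exists n, has_walk x n.
Proof.
case: treeG => _ /(_ x r)/connectP[p xp pr] _.
by exists (size p); apply: has_walkP.
Qed.

Let dist x := ex_minn (ex_walk x).

Let dist_min x p : path (@edge G) x p -> last x p = r -> dist x <= size p.
Proof.
by move=> xp pr; rewrite /dist; case: ex_minnP => n _; apply; apply: has_walkP.
Qed.

(** The second vertex of a shortest walk to r both leads to r while avoiding x and
    is nearer to r. *)
Let step x : x != r -> exists y, toward x y && (dist y < dist x).
Proof.
move=> xr; rewrite {2}/dist; case: ex_minnP => n /existsP[p0 /andP[xp0 /eqP p0r]] nmin.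
have : size (shorten x p0) <= n.
  case/shortenP: xp0 p0r => p xp Up subp _.
  have := uniq_leq_size (proj2 (andP Up)) subp; by rewrite size_tuple.
case/shortenP: xp0 p0r => p xp Up _ pr le_pn.
case: p => [|y p] in xp Up pr le_pn; first by rewrite -pr /= eqxx in xr.
move: xp => /= /andP[xy yp]; exists y; rewrite /toward xy /=.
apply/andP; split; last by apply: leq_ltn_trans (dist_min yp pr) _.
apply/connectP; exists p => //; apply: path_avoid => //.
by case/andP: Up.
Qed.

Let par x := if x == r then r else
  odflt x [pick y | toward x y && (dist y < dist x)].

Let par_up x : x != r -> toward x (par x) && (dist (par x) < dist x).
Proof.
move=> xr; rewrite /par (negbTE xr); case: pickP => //= none.
by have [y] := step xr; rewrite none.
Qed.

(** For an edge x y, either y reaches r while avoiding x, and then y is the parent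
    of x, or a simple path from y to r passes through x, and its tail from x
    avoids y, so that x is the parent of y. *)
Let par_edge x y : edge x y =
  ((x != r) && (par x == y)) || ((y != r) && (par y == x)).
Proof.
have parE u v : u != r -> toward u v -> par u = v.
  by move=> ur uv; have /andP[uw _] := par_up ur; apply: toward_uniq uw uv.
apply/idP/idP => [xy|]; last first.
  case/orP=> /andP[ur /eqP<-]; have /andP[/andP[uw _] _] := par_up ur => //.
  by rewrite edge_sym.
have [xr|xr] := eqVneq x r.
  have yr : y != r by apply: contraTneq xy => ->; rewrite xr edge_irr.
  by rewrite yr (parE y x) ?eqxx //= /toward edge_sym xy xr connect0.
have [yr|yr] := eqVneq y r.
  by rewrite (parE x y) ?eqxx //= /toward xy yr connect0.
have [tw|ntw] := boolP (connect (avoid x) y r).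
  by rewrite (parE x y) ?eqxx //= /toward xy tw.
rewrite (parE y x) ?eqxx ?orbT //= /toward edge_sym xy /=.
case: treeG => _ /(_ y r)/connectP[p0 yp0 rE] _.
case/shortenP: yp0 rE => p yp Up _ rE.
have xp : x \in y :: p.
  apply: contraNT ntw => xp; apply/connectP; exists p => //; exact: path_avoid.
have {}xp : x \in p.
  by move: xp; rewrite inE => /orP[/eqP xy'|//]; rewrite xy' edge_irr in xy.
case/splitPr: xp => p1 p2 in yp Up rE *.
apply/connectP; exists p2; last by rewrite rE last_cat.
apply: path_avoid; first by move: yp; rewrite cat_path /= => /and3P[].
by move: Up; rewrite /= mem_cat negb_or => /andP[/andP[]].
Qed.

Lemma tree_rooting : exists R : rooting G, base R = r.
Proof.
have par_r : par r = r by rewrite /par eqxx.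
have par_lt x : x != r -> dist (par x) < dist x by case/par_up/andP.
by exists (Rooting par_r par_lt par_edge).
Qed.

End TreeRooting.

Section Rooted.
Variables (G : sgraph) (R : rooting G).
Local Notation r := (base R).
Local Notation par := (parent R).
Local Notation dep := (rank R).

(** Since the base is its own parent, iterating [parent] is harmless there. *)
Definition desc (x : G) : {set G} := [set y | fconnect par y x].
Definition children (x : G) : {set G} := [set y | (y != r) && (par y == x)].

Lemma desc_refl x : x \in desc x.
Proof. by rewrite inE connect0. Qed.

Lemma desc_trans x y z : x \in desc y -> y \in desc z -> x \in desc z.
Proof. by rewrite !inE; apply: connect_trans. Qed.

Lemma desc_down x y : par y \in desc x -> y \in desc x.
Proof. by apply: desc_trans; rewrite inE fconnect1. Qed.

Lemma desc_up x y : y \in desc x -> y != x -> par y \in desc x.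
Proof.
rewrite !inE => /connectP[[|z p] /= yp ->]; first by rewrite eqxx.
by case/andP: yp => /eqP-> zp _; apply/connectP; exists p.
Qed.

Lemma rank_ind (P : G -> Prop) :
  (forall x, (x != r -> P (par x)) -> P x) -> forall x, P x.
Proof.
move=> IH x; have [n] := ubnP (dep x); elim: n x => // n IHn x.
rewrite ltnS => xn; apply: IH => /rank_parent xr.
by apply: IHn; apply: leq_trans xr xn.
Qed.

Lemma desc_base x : x \in desc r.
Proof.
elim/rank_ind: x => x IH; have [->|/IH] := eqVneq x r; first exact: desc_refl.
exact: desc_down.
Qed.

Lemma desc_of_base x : (r \in desc x) -> x = r.
Proof.
rewrite inE => /connectP[p rp ->]; elim: p rp => //= y p IHp /andP[/eqP ry].
by rewrite -ry parent_base; apply: IHp.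
Qed.

Lemma desc_rank x y : y \in desc x -> y != x -> dep x < dep y.
Proof.
elim/rank_ind: y => y IH yx y_x.
have yr : y != r by apply: contraNneq y_x => yr; move: yx; rewrite yr => /desc_of_base->.
have [<-|ny] := eqVneq (par y) x; first exact: rank_parent.
by apply: ltn_trans (IH yr (desc_up yx y_x) ny) (rank_parent yr).
Qed.

Lemma desc_anti x y : x \in desc y -> y \in desc x -> x = y.
Proof.
move=> xy yx; apply: contraTeq isT => ne.
have ne' : y != x by rewrite eq_sym.
by have := ltn_trans (desc_rank xy ne) (desc_rank yx ne'); rewrite ltnn.
Qed.

Lemma parent_notin_desc x : x != r -> par x \notin desc x.
Proof.
move=> xr; have lt := rank_parent xr; apply/negP => /desc_rank.
have -> : par x != x by apply: contraTneq lt => ->; rewrite ltnn.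
by move=> /(_ isT); rewrite ltnNge ltnW.
Qed.

Lemma desc_children x y :
  (y \in desc x) = (y == x) || [exists c in children x, y \in desc c].
Proof.
apply/idP/idP => [|/orP[/eqP->|/existsP[c /andP[]]]]; last 2 first.
- exact: desc_refl.
- rewrite inE => /andP[_ /eqP<-] yc; apply: desc_trans yc _.
  by apply: desc_down; apply: desc_refl.
elim/rank_ind: y => y IH yx; have [//|y_x] := eqVneq y x; apply/existsP.
have yr : y != r by apply: contraNneq y_x => yr; move: yx; rewrite yr => /desc_of_base->.
have [pyx|_] := eqVneq (par y) x.
  by exists y; rewrite inE yr pyx eqxx desc_refl.
have /orP[/eqP pyx|/existsP[c /andP[cx pc]]] := IH yr (desc_up yx y_x).
  by exists y; rewrite inE yr pyx eqxx desc_refl.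
by exists c; rewrite cx desc_down.
Qed.

(** The ancestors of a vertex form a chain. *)
Lemma desc_total x x' y : y \in desc x -> y \in desc x' ->
  (x \in desc x') || (x' \in desc x).
Proof.
elim/rank_ind: y => y IH yx yx'.
have [<-|yN] := eqVneq y x; first by rewrite yx'.
have [<-|yN'] := eqVneq y x'; first by rewrite yx orbT.
have yr : y != r by apply: contraNneq yN => yr; move: yx; rewrite yr => /desc_of_base->.
by apply: IH => //; apply: desc_up.
Qed.

(** In a rooted tree the vertex sets of subtrees are those from which one
    can climb, inside the set, to a single top. *)
Definition top_at (t : G) (A : {set G}) : bool :=
  (t \in A) && [forall x in A, (x != t) ==> (x != r) && (par x \in A)].

Lemma top_atP t (A : {set G}) : reflect
  (t \in A /\ forall x, x \in A -> x != t -> x != r /\ par x \in A) (top_at t A).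
Proof.
apply: (iffP andP) => [] [tA H]; split=> //.
  by move=> x xA xt; apply/andP; move/forall_inP: H => /(_ x xA)/implyP; apply.
by apply/forall_inP=> x xA; apply/implyP=> xt; apply/andP; apply: H.
Qed.

Lemma top_at_desc t (A : {set G}) : top_at t A -> A \subset desc t.
Proof.
case/top_atP=> tA H; apply/subsetP; elim/rank_ind=> x IH xA.
have [->|xt] := eqVneq x t; first exact: desc_refl.
by have [xr pA] := H x xA xt; apply/desc_down/IH.
Qed.

Lemma top_at_uniq t t' (A : {set G}) : top_at t A -> top_at t' A -> t = t'.
Proof.
move=> tA t'A; have [/subsetP s /subsetP s'] := (top_at_desc tA, top_at_desc t'A).
by apply: desc_anti; [apply: s'; case/andP: tA|apply: s; case/andP: t'A].
Qed.

(** Climbing inside A from x towards t leaves the branch of u through u. *)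
Lemma top_at_ancestor t (A : {set G}) u x : top_at t A -> x \in A -> x \in desc u ->
  t \notin desc u -> u \in A.
Proof.
move=> /top_atP[tA H]; elim/rank_ind: x => x IH xA xu tu.
have [<-//|x_u] := eqVneq x u.
have [xr pA] := H x xA (contraNneq (fun E => etrans (congr1 _ (esym E)) xu) tu).
by apply: (IH xr pA _ tu); apply: desc_up.
Qed.

End Rooted.

(** A subtree of a tree is determined by its vertex set, see [subtreeE]. *)
Definition tree_set (G : sgraph) (A : {set G}) : bool := subtree (A, edges_in A).

Lemma edges_inP (G : sgraph) (A : {set G}) (e : {set G}) :
  reflect (exists x y, [/\ x \in A, y \in A, edge x y & e = [set x; y]])
          (e \in edges_in A).
Proof.
apply: (iffP imset2P) => [[x y xA]|[x [y [xA yA xy ->]]]].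
  by rewrite inE => /andP[yA xy] ->; exists x, y.
by exists x y; rewrite // inE yA.
Qed.

Lemma set2_eq (T : finType) (a b x y : T) :
  [set a; b] = [set x; y] -> (a = x /\ b = y) \/ (a = y /\ b = x).
Proof.
move=> E.
have aE : a \in [set x; y] by rewrite -E set21.
have bE : b \in [set x; y] by rewrite -E set22.
have xE : x \in [set a; b] by rewrite E set21.
have yE : y \in [set a; b] by rewrite E set22.
move: aE bE xE yE; rewrite !inE.
do 4![case/orP=> /eqP ?]; subst; auto.
Qed.

Lemma pair_in_edges (G : sgraph) (A : {set G}) x y :
  ([set x; y] \in edges_in A) = [&& x \in A, y \in A & edge x y].
Proof.
apply/edges_inP/and3P => [[a [b [aA bA ab /set2_eq E]]]|[xA yA xy]].
  by case: E => [] [-> ->]; split=> //; rewrite edge_sym.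
by exists x, y.
Qed.

Section RootedSubtrees.
Variables (G : sgraph) (R : rooting G).
Local Notation r := (base R).
Local Notation par := (parent R).

(** The only edge of the tree that leaves the branch of x is the one from x to its
    parent; a connected S without it stays in the branch. *)
Lemma subtree_below (S : subgraph_data G) x : subtree S -> x \in S.1 ->
  (x == r) || ([set x; par x] \notin S.2) -> S.1 \subset desc R x.
Proof.
case/and3P=> /subsetP subS _ /forall_inP conS xS xout.
apply/subsetP=> y yS.
have /forall_inP/(_ _ yS)/connectP[p xp ->] := conS x xS.
elim/last_ind: p xp => [|p z IHp]; first by rewrite desc_refl.
rewrite rcons_path last_rcons => /andP[/IHp {IHp}]; move: (last x p) => w wx wz.
have /subS := wz; rewrite pair_in_edges => /and3P[wS zS].
rewrite (edge_parent R) => /orP[/andP[wr /eqP zE]|/andP[zr /eqP pz]]; last first.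
  by apply: desc_down; rewrite pz.
move: wx; have [wE|wN wx] := eqVneq w x; last by rewrite -zE; apply: desc_up.
by move: wz xout; rewrite /subedge -zE wE => ->; rewrite orbF -wE (negbTE wr).
Qed.

(** A vertex of least rank is a top: were the edge from another vertex x to its
    parent absent, all of S would lie in the branch of x, whose other vertices
    have rank larger than that of x. *)
Lemma subtree_top (S : subgraph_data G) : subtree S ->
  (exists t, top_at R t S.1) /\ S.2 = edges_in S.1.
Proof.
move=> treeS; have [/subsetP subS S0 _] := and3P treeS.
split; last first.
  apply/eqP; rewrite eqEsubset (introT subsetP subS) /=.
  have key x y : x \in S.1 -> y \in S.1 -> x != r -> par x = y -> [set x; y] \in S.2.
    move=> xS yS xr yE; apply: contraNT (parent_notin_desc xr) => nin.
    by rewrite yE; apply: (subsetP (subtree_below treeS xS _)); rewrite // yE nin orbT.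
  apply/subsetP=> _ /edges_inP[x [y [xS yS xy ->]]].
  move: xy; rewrite (edge_parent R) => /orP[/andP[xr /eqP]|/andP[yr /eqP]].
    exact: key.
  by rewrite setUC; apply: key.
case/set0Pn: S0 => t0 t0S.
case: (arg_minnP (rank R) t0S) => t tS tmin; exists t; apply/top_atP; split=> // x xS xt.
have [/(subtree_below treeS xS)/subsetP/(_ t tS) tx|] :=
  boolP ((x == r) || ([set x; par x] \notin S.2)).
  have := desc_rank tx; rewrite eq_sym xt => /(_ isT).
  by rewrite ltnNge tmin.
rewrite negb_or negbK => /andP[xr /subS]; rewrite pair_in_edges.
by case/and3P.
Qed.

Lemma tree_setE (A : {set G}) : tree_set A = [exists t, top_at R t A].
Proof.
apply/idP/existsP => [/subtree_top[]//|[t tA]].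
apply/and3P; split=> /=; rewrite ?/subgraph //.
  by apply/set0Pn; exists t; case/andP: tA.
have csym : connect_sym (subedge (A, edges_in A)).
  by apply: sym_connect_sym => x y; rewrite /subedge setUC.
have con x : x \in A -> connect (subedge (A, edges_in A)) x t.
  have [_ H] := top_atP _ _ _ tA; elim/(rank_ind (R := R)): x => x IH xA.
  have [->|xt] := eqVneq x t; first exact: connect0.
  have [xr pA] := H x xA xt; apply: connect_trans (IH xr pA); apply: connect1.
  by rewrite /subedge pair_in_edges /= xA pA (edge_parent R) xr eqxx.
apply/forall_inP=> x xA; apply/forall_inP=> y yA.
by apply: connect_trans (con x xA) _; rewrite csym; apply: con.
Qed.

Lemma subtreeE (S : subgraph_data G) :
  subtree S = (S.2 == edges_in S.1) && tree_set S.1.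
Proof.
apply/idP/idP => [treeS|/andP[/eqP E]]; last by case: S E => A B /= ->.
have [exT E] := subtree_top treeS; rewrite E eqxx tree_setE.
by apply/existsP.
Qed.

(** On a cycle, both neighbours of a vertex of largest rank are its parent. *)
Lemma rooting_tree : is_tree G.
Proof.
have con x : connect (@edge G) x r.
  elim/(rank_ind (R := R)): x => x IH; have [->|xr] := eqVneq x r; first exact: connect0.
  by apply: connect_trans (IH xr); apply: connect1; rewrite (edge_parent R) xr eqxx.
have csym : connect_sym (@edge G) by apply: sym_connect_sym; apply: edge_sym.
split; first by apply/card_gt0P; exists r.
  by move=> x y; apply: connect_trans (con x) _; rewrite csym.
move=> c0 c0gt c0cyc.
have [x0 x0c] : exists x0, x0 \in c0 by case: c0 c0gt {c0cyc} => // a s; exists a; rewrite mem_head.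
case: (arg_maxnP (rank R) x0c) => x xc xmax.
have [i c cE] := rot_to xc.
have cyc : ucycle (@edge G) (x :: c) by rewrite /ucycle -cE rot_cycle rot_uniq.
have cgt : 1 < size c by rewrite -ltnS -/(size (x :: c)) -cE size_rot.
have par_of y : y \in x :: c -> edge x y -> y = par x.
  rewrite -cE mem_rot => /xmax; rewrite (edge_parent R) => yx.
  case/orP=> /andP[yr /eqP]; first by [].
  by move=> pyx; have := rank_parent yr; rewrite pyx ltnNge (yx : _ <= _).
case: c => [|y c] // in cE cyc cgt par_of *.
case/andP: cyc; rewrite /= rcons_path => /and3P[xy yc lx] /and3P[_ ync _].
have yE : y = par x by apply: par_of; rewrite // !inE eqxx orbT.
have lE : last y c = par x by apply: par_of; rewrite 1?edge_sym // inE mem_last orbT.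
case: c => [|z c] // in cE yc lx cgt par_of ync lE *.
by move: ync; rewrite yE -lE /= mem_last.
Qed.

Lemma sum_tree_set (V : nmodType) (F : {set G} -> V) :
  (\sum_(A : {set G} | tree_set A) F A = \sum_t \sum_(A | top_at R t A) F A)%R.
Proof.
rewrite (exchange_big_dep (fun A : {set G} => tree_set A)) /=; last first.
  by move=> t A _ tA; rewrite tree_setE; apply/existsP; exists t.
apply: eq_bigr => A; rewrite tree_setE => /existsP[t tA].
rewrite (big_pred1 t) // => t' /=; apply/idP/eqP => [t'A|->//].
exact: top_at_uniq t'A tA.
Qed.

End RootedSubtrees.

Section Split.
Variables (G : sgraph) (R : rooting G).
Local Notation r := (base R).
Local Notation par := (parent R).
Local Notation children := (children R).
Local Notation desc := (desc R).

Lemma top_at_single x : top_at R x [set x].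
Proof.
apply/top_atP; split=> [|y]; rewrite inE // => yx; by rewrite (eqP yx) eqxx.
Qed.

Lemma top_at_no_child x (A : {set G}) : top_at R x A ->
  (forall c, c \in children x -> c \notin A) -> A = [set x].
Proof.
move=> xA nc; have [xinA _] := andP xA.
apply/eqP; rewrite eqEsubset sub1set xinA andbT.
apply/subsetP=> y yA; rewrite inE.
have := subsetP (top_at_desc xA) y yA.
rewrite desc_children => /orP[//|/existsP[c /andP[cx yc]]].
have cA := nc c cx; case/negP: cA; apply: (top_at_ancestor xA yA yc).
by move: cx; rewrite inE => /andP[cr /eqP<-]; apply: parent_notin_desc.
Qed.

(** A subtree with top par u that contains u is a subtree with that top that avoids
    u, glued to a subtree with top u. This one bijection yields both the
    recursion along limbs and the comparison of local means. *)
Lemma sum_top_at_split u (V : nmodType) (F : {set G} -> V) : u != r ->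
  (\sum_(A | top_at R (par u) A && (u \in A)) F A =
   \sum_(A | top_at R (par u) A && (u \notin A)) \sum_(B | top_at R u B) F (A :|: B))%R.
Proof.
move=> ur; have pu := parent_notin_desc ur; rewrite pair_big_dep /=.
rewrite (reindex_onto (fun p : {set G} * {set G} => p.1 :|: p.2)
  (fun A => (A :\: desc u, A :&: desc u))) /=; last first.
  by move=> A _; rewrite setUC setID.
apply: eq_bigl => -[A B] /=; rewrite xpair_eqE.
apply/andP/andP => [[/andP[topC uC] /andP[/eqP AE /eqP BE]]|[/andP[topA uA] topB]].
  move: (A :|: B) AE BE topC uC => C <- <- {A B} /top_atP[pC H] uC.
  rewrite in_setD desc_refl /=; split.
    rewrite andbT; apply/top_atP; split=> [|x]; rewrite !in_setD ?pu //.
    case/andP=> xu xC xp; have [xr pxC] := H x xC xp; split=> //.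
    by rewrite pxC andbT; apply: contra xu; apply: desc_down.
  apply/top_atP; split=> [|x]; rewrite in_setI ?uC ?desc_refl //.
  case/andP=> xC xu x_u; have [|xr pxC] := H x xC.
    by apply: contraNneq pu => <-.
  by split=> //; rewrite in_setI pxC; apply: desc_up.
have BD := top_at_desc topB.
have AD : [disjoint A & desc u].
  apply/pred0P => x /=; apply: contraNF uA => /andP[xA xu].
  exact: top_at_ancestor topA xA xu pu.
have uB : u \in B by case/andP: topB.
rewrite in_setU uB orbT andbT; split; last first.
  rewrite setDUl setIUl (setDidPl AD) (setIidPl BD).
  have -> : A :&: desc u = set0 by apply/disjoint_setI0.
  by rewrite set0U eqxx andbT (_ : B :\: desc u = set0) ?setU0 //; apply/eqP; rewrite setD_eq0.
have [pA HA] := top_atP _ _ _ topA; have [_ HB] := top_atP _ _ _ topB.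
apply/top_atP; split=> [|x]; rewrite !in_setU ?pA //.
case/orP=> [/HA{}HA /HA[-> ->] //|xB _].
have [->|xu] := eqVneq x u; first by rewrite pA.
by have [-> ->] := HB x xB xu; rewrite orbT.
Qed.

End Split.

(** * Limbs in a rooted tree *)

Section Hairs.
Variables (G : sgraph) (R : rooting G).
Local Notation r := (base R).
Local Notation par := (parent R).
Local Notation children := (children R).
Local Notation desc := (desc R).

(** When the base has degree at least 3 these are the vertices of the limbs,
    see [core_hairs]. *)
Definition hairs : {set G} := [set x | [forall y in desc x, #|children y| <= 1]].
Definition hair (x : G) : subgraph_data G := (desc x, edges_in (desc x)).

Lemma desc_child x c : c \in children x -> c \in desc x.
Proof. by rewrite inE => /andP[_ /eqP<-]; apply/desc_down/desc_refl. Qed.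

Lemma child_desc x c : c \in children x -> x \notin desc c.
Proof. by rewrite inE => /andP[cr /eqP<-]; apply: parent_notin_desc. Qed.

Lemma desc_child_proper x c : c \in children x -> desc c \proper desc x.
Proof.
move=> cx; apply/properP; split; last by exists x; rewrite ?desc_refl // child_desc.
by apply/subsetP=> y yc; apply: desc_trans yc (desc_child cx).
Qed.

Lemma hairsP x : reflect (forall y, y \in desc x -> #|children y| <= 1) (x \in hairs).
Proof. by rewrite inE; apply: forall_inP. Qed.

Lemma hairs_desc x y : x \in hairs -> y \in desc x -> y \in hairs.
Proof.
by move=> /hairsP xU yx; apply/hairsP => z zy; apply: xU; apply: desc_trans yx.
Qed.

Lemma hairs_step x : #|children x| <= 1 ->
  (forall c, c \in children x -> c \in hairs) -> x \in hairs.
Proof.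
move=> cx H; apply/hairsP=> y; rewrite desc_children => /orP[/eqP->//|].
by case/existsP=> c /andP[/H/hairsP]; apply.
Qed.

(** A branch in which no vertex has two children is a path, so induction can
    proceed from its leaf upwards. *)
Lemma hair_ind (P : G -> Prop) :
  (forall x, x \in hairs -> children x = set0 -> P x) ->
  (forall x c, x \in hairs -> children x = [set c] -> c \in hairs -> P c -> P x) ->
  forall x, x \in hairs -> P x.
Proof.
move=> P0 P1 x; have [n] := ubnP #|desc x|; elim: n x => // n IHn x.
rewrite ltnS => xn xU; have [/eqP|ne] := boolP (children x == set0); first exact: P0.
have /cards1P[c cE] : #|children x| == 1.
  by rewrite eqn_leq (hairsP _ xU) ?desc_refl // card_gt0.
have cx : c \in children x by rewrite cE set11.
have cU := hairs_desc xU (desc_child cx).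
apply: (P1 x c) => //; apply: IHn => //; apply: leq_trans xn.
exact/proper_card/desc_child_proper.
Qed.

Lemma desc0 x : children x = set0 -> desc x = [set x].
Proof.
move=> E; apply/setP=> y; rewrite desc_children inE E.
by case: existsP => [[c]|_]; rewrite ?inE ?orbF.
Qed.

Lemma desc1 x c : children x = [set c] -> desc x = x |: desc c.
Proof.
move=> E; apply/setP=> y; rewrite desc_children !inE E; congr (_ || _).
apply/existsP/idP => [[c' /andP[]]|yc]; first by rewrite !inE => /eqP->.
by exists c; rewrite !inE eqxx.
Qed.

Lemma edges_in1 x : edges_in [set x : G] = set0.
Proof.
apply/eqP; rewrite -subset0; apply/subsetP=> e /edges_inP[a [b []]].
by rewrite !inE => /eqP-> /eqP->; rewrite edge_irr.
Qed.

Lemma children_edge x c : c \in children x -> edge x c.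
Proof. by rewrite inE (edge_parent R) => ->; rewrite orbT. Qed.

Lemma desc_edge x y : y \in desc x -> edge x y -> y \in children x.
Proof.
move=> yx; rewrite (edge_parent R) inE => /orP[/andP[xr /eqP E]|->//].
by rewrite -E in yx; case/negP: (parent_notin_desc xr).
Qed.

Lemma edges_in_desc1 x c : children x = [set c] ->
  edges_in (desc x) = [set x; c] |: edges_in (desc c).
Proof.
move=> E; have cx : c \in children x by rewrite E set11.
have nb y : y \in desc x -> edge x y -> y = c.
  by move=> yx /(desc_edge yx); rewrite E inE => /eqP.
apply/setP=> e; apply/edges_inP/idP => [[a [b [ax bx ab ->]]]|].
  rewrite in_setU1; have [aE|aN] := eqVneq a x.
    by rewrite (nb b) -?aE ?eqxx // aE.
  have [bE|bN] := eqVneq b x.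
    by rewrite bE (nb a) 1?setUC ?eqxx // -bE edge_sym.
  rewrite pair_in_edges ab andbT.
  move: ax bx; rewrite (desc1 E) !in_setU1 (negbTE aN) (negbTE bN) /= => -> ->.
  by rewrite orbT.
rewrite in_setU1 => /orP[/eqP->|/edges_inP[a [b [ac bc ab ->]]]].
  by exists x, c; split; rewrite ?desc_refl ?desc_child ?children_edge.
by exists a, b; split=> //; rewrite (desc1 E) in_setU1 ?ac ?bc orbT.
Qed.

Lemma hair_path x : x \in hairs -> path_from (hair x) x.
Proof.
move=> xU.
suff [p [xp Up xE]] : exists p, [/\ path (@edge G) x p, uniq (x :: p)
                          & hair x = walk_subgraph x p].
  have sp : size p < #|G| by have := card_uniqP Up; rewrite /= => <-; apply: max_card.
  apply/existsP; exists (Ordinal sp); apply/existsP; exists (in_tuple p).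
  by rewrite xp xE eqxx andbT; apply/andP.
elim/hair_ind: x / xU => [x xU x0|x c xU E cU [p [cp Up [dE eE]]]].
  exists [::]; split=> //; rewrite /hair desc0 // edges_in1; congr (_, _).
    by apply/setP=> y; rewrite !inE.
  by apply/setP=> e; rewrite inE; apply/esym/imsetP; case.
have cx : c \in children x by rewrite E set11.
exists (c :: p); split.
- by rewrite /= children_edge.
- rewrite cons_uniq Up andbT; apply: contra (child_desc cx).
  by rewrite dE inE.
- rewrite /hair (edges_in_desc1 E) (desc1 E) eE dE; congr (_, _).
    by apply/setP=> y; rewrite !inE.
  apply/setP=> e; rewrite in_setU1; apply/orP/imsetP.
    case=> [/eqP->|/imsetP[f fz ->]]; first by exists (x, c); rewrite ?inE ?eqxx.
    by exists f => //; move: fz; rewrite !inE => ->; rewrite orbT.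
  case=> f /=; rewrite inE => /orP[/eqP->|fz] ->; first by left.
  by right; apply: (imset_f (fun e : G * G => [set e.1; e.2])).
Qed.

Lemma degree_parent x : degree x = (x != r) + #|children x|.
Proof.
rewrite /degree; have [->|xr] := eqVneq x r; rewrite ?add0n.
  by apply: eq_card => y; rewrite !inE (edge_parent R) eqxx.
have pN : par x \notin children x.
  rewrite inE negb_and; have [//|pr /=] := eqVneq (par x) r.
  have := ltn_trans (rank_parent pr) (rank_parent xr).
  by apply: contraTneq => ->; rewrite ltnn.
rewrite -[(_ + _)%N]/(true + #|children x|)%N -pN -cardsU1; apply: eq_card => y.
by rewrite !inE (edge_parent R) xr /= eq_sym.
Qed.

End Hairs.

Lemma walk_mem (G : sgraph) (u : G) p (B : {set G}) : path (@edge G) u p ->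
  (forall a b, a \in u :: p -> b \in u :: p -> edge a b -> a \in B -> b \in B) ->
  forall z, z \in u :: p -> (z \in B) = (u \in B).
Proof.
elim: p u => [|w p IHp] u /=; first by move=> _ _ z; rewrite inE => /eqP->.
case/andP=> uw wp H z; rewrite inE => /predU1P[->//|zp].
have wu : (w \in B) = (u \in B).
  by apply/idP/idP; apply: H; rewrite ?mem_head // ?in_cons ?eqxx ?orbT // edge_sym.
rewrite -wu; apply: IHp => // a b ap bp; apply: H; rewrite in_cons ?ap ?bp orbT //.
Qed.

Lemma walk_edges (G : sgraph) (u : G) p : path (@edge G) u p ->
  (walk_subgraph u p).2 \subset edges_in (walk_subgraph u p).1.
Proof.
move=> up; apply/subsetP=> _ /imsetP[[a b] abz ->] /=.
suff: [&& a \in u :: p, b \in u :: p & edge a b].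
  by rewrite pair_in_edges !inE.
elim: p u up abz => //= w p IHp u /andP[uw wp]; rewrite inE.
case/orP=> [/eqP[-> ->]|/(IHp _ wp)/and3P[ap bp ->]]; first by rewrite !inE !eqxx orbT.
by rewrite andbT in_cons ap orbT in_cons bp orbT.
Qed.

Section Limbs.
Variables (G : sgraph) (R : rooting G).
Local Notation r := (base R).
Local Notation par := (parent R).
Local Notation children := (children R).
Local Notation desc := (desc R).
Local Notation hairs := (hairs R).
Local Notation hair := (hair R).
Hypothesis deg3 : 2 < degree r.

(** The end vertex of a limb that is next to the core. *)
Definition hairtop (x : G) := (x \in hairs) && (par x \notin hairs).
Definition attached (v : G) : {set G} := [set x | hairtop x && (par x == v)].

Lemma base_notin_hairs : r \notin hairs.
Proof.
apply/hairsP => /(_ _ (desc_refl R r)).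
by have d := deg3; rewrite (degree_parent R) eqxx in d; rewrite leqNgt (ltnW d).
Qed.

Lemma hairs_base x : x \in hairs -> x != r.
Proof. by apply: contraTneq => ->; apply: base_notin_hairs. Qed.

Lemma parent_notin_hairs x : x \notin hairs -> par x \notin hairs.
Proof.
by apply: contra => /hairs_desc; apply; apply/desc_down/desc_refl.
Qed.

Lemma child_of x : x != r -> x \in children (par x).
Proof. by move=> xr; rewrite inE xr eqxx. Qed.

Lemma hairtop_desc y : y \in hairs -> exists2 x, hairtop x & y \in desc x.
Proof.
elim/(rank_ind (R := R)): y => y IH yU.
have [pU|pN] := boolP (par y \in hairs).
  have [x xt yx] := IH (hairs_base yU) pU; exists x => //; exact: desc_down.
by exists y; rewrite ?desc_refl // /hairtop yU.
Qed.

Lemma hairtop_anti x x' : hairtop x -> hairtop x' -> x \in desc x' -> x = x'.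
Proof.
case/andP=> xU pN /andP[x'U _] xx'; apply: contraNeq pN => ne.
exact: hairs_desc x'U (desc_up xx' ne).
Qed.

Lemma hairtop_uniq x x' y : hairtop x -> hairtop x' ->
  y \in desc x -> y \in desc x' -> x = x'.
Proof.
move=> xt x't yx yx'; have /orP[] := desc_total yx yx'; first exact: hairtop_anti.
by move/hairtop_anti => ->.
Qed.

(** A vertex other than the base, of degree at most 2 and with a child in [hairs], has no
    other child, so it would itself be in [hairs]. *)
Lemma degree_attach x : hairtop x -> 2 < degree (par x).
Proof.
case/andP=> xU pN; have [->//|pr] := eqVneq (par x) r.
rewrite (degree_parent R) pr add1n ltnS ltnNge; apply: contra pN => c1.
apply: (hairs_step c1) => c cp; suff -> : c = x by [].
have xp := child_of (hairs_base xU).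
by apply/eqP; apply: contraTT c1 => cx; rewrite -ltnNge; apply/card_gt1P; exists c, x.
Qed.

(** To leave the branch of x, the path P would have to use the parent of x, whose
    degree is at least 3. *)
Lemma candidate_in_hair x y (P : subgraph_data G) : hairtop x ->
  limb_candidate P -> y \in P.1 -> y \in desc x -> sub_le P (hair x).
Proof.
move=> xt /and3P[/existsP[u /existsP[n /existsP[p /and3P[up _ /eqP->]]]] _].
move/forall_inP=> deg2 yP yx.
have sub : (walk_subgraph u p).1 \subset desc x.
  have mem z : z \in u :: p -> (z \in desc x) = (u \in desc x).
    apply: walk_mem up _ z => a b ap bp; rewrite (edge_parent R) => ab ax.
    case/orP: ab => /andP[_ /eqP E]; last by apply: desc_down; rewrite E.
    have bN : b != par x.
      apply: contraTneq (degree_attach xt) => <-; rewrite -leqNgt.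
      by apply: deg2; rewrite inE.
    by rewrite -E; apply: desc_up => //; apply: contraNneq bN => <-; rewrite E.
  apply/subsetP=> z; rewrite inE => /mem->; rewrite -(mem y) //.
  by move: yP; rewrite inE.
rewrite /sub_le sub; apply: subset_trans (walk_edges up) _.
apply/subsetP=> e /edges_inP[a [b [ap bp ab ->]]].
by apply/edges_inP; exists a, b; rewrite !(subsetP sub).
Qed.

Lemma degree_hair x : x \in hairs -> degree x = #|children x|.+1.
Proof. by move/hairs_base=> xr; rewrite (degree_parent R) xr. Qed.

Lemma hair_candidate x : x \in hairs -> limb_candidate (hair x).
Proof.
move=> xU; apply/and3P; split.
- by apply/existsP; exists x; apply: hair_path.
- apply/exists_inP; elim/hair_ind: x / xU => [x xU x0|x c xU xc cU [y yc ly]].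
    by exists x; rewrite ?desc_refl // /leaf degree_hair // x0 cards0.
  by exists y => //; apply: desc_trans yc _; apply: desc_child; rewrite xc set11.
- apply/forall_inP=> y yx; rewrite degree_hair ?(hairs_desc xU) // ltnS.
  by apply: (hairsP _ _ xU).
Qed.

(** A branch below a hair top is a candidate and contains every candidate that it
    meets, so it is maximal; conversely a limb meets such a branch at its leaf. *)
Lemma limb_hair L : limb L = (L \in hair @: [set x | hairtop x]).
Proof.
apply/andP/imsetP => [[Lc /forallP Lmax]|[x]]; last first.
  rewrite inE => xt ->; have /andP[xU _] := xt; split; first exact: hair_candidate.
  apply/forallP=> P; apply/implyP=> /andP[Pc LP].
  have yP : x \in P.1 by case/andP: LP => /subsetP + _; apply; apply: desc_refl.
  have := candidate_in_hair xt Pc yP (desc_refl R x).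
  move: LP => /andP[s1 s2] /andP[t1 t2].
  by rewrite -pair_eqE /pair_eq !eqEsubset s1 s2 t1 t2.
have /and3P[_ /exists_inP[y yL ly] _] := Lc.
have yr : y != r.
  by apply: contraTneq deg3 => <-; rewrite -leqNgt (eqP ly).
have y0 : children y = set0.
  by move: ly; rewrite /leaf (degree_parent R) yr add1n eqSS cards_eq0 => /eqP.
have yU : y \in hairs by apply: hairs_step => [|c]; rewrite y0 ?cards0 ?inE.
have [x xt yx] := hairtop_desc yU; exists x; first by rewrite inE.
have := Lmax (hair x); rewrite (candidate_in_hair xt Lc yL yx) hair_candidate //.
  by move/eqP.
by case/andP: xt.
Qed.

Lemma core_hairs : core_set G = ~: hairs.
Proof.
congr (~: _); apply/setP=> y; apply/bigcupP/idP => [[L]|yU].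
  rewrite limb_hair => /imsetP[x]; rewrite inE => /andP[xU _] -> /=.
  exact: hairs_desc.
have [x xt yx] := hairtop_desc yU; exists (hair x) => //.
by rewrite limb_hair imset_f // inE.
Qed.

Lemma edge_hairs u v : u \in hairs -> v \notin hairs -> edge u v = (par u == v).
Proof.
move=> uU vN; rewrite (edge_parent R) (hairs_base uU) /=.
case: eqP => //= _; apply: contraNF vN => /andP[vr /eqP pv].
by apply: hairs_desc uU _; rewrite -pv; apply/desc_down/desc_refl.
Qed.

Lemma limb_adjacent_hair x v : hairtop x -> v \notin hairs ->
  limb_adjacent (hair x) v = (par x == v).
Proof.
move=> xt vN; have /andP[xU _] := xt.
apply/existsP/eqP => [[u /andP[/existsP[n /existsP[p /and3P[_ _ /eqP E]]] uv]]|<-].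
  have ux : u \in desc x by rewrite (congr1 fst E : desc x = _) inE mem_head.
  have uU := hairs_desc xU ux; move: uv; rewrite edge_hairs // => /eqP uv.
  have [<-//|u_x] := eqVneq u x; case/negP: vN; rewrite -uv.
  exact: hairs_desc xU (desc_up ux u_x).
exists x; rewrite hair_path //= edge_hairs //; by case/andP: xt.
Qed.

Lemma limbs_at_hair v : v \notin hairs -> limbs_at v = hair @: attached v.
Proof.
move=> vN; apply/setP=> L; rewrite inE limb_hair.
apply/andP/imsetP => [[/imsetP[x]]|[x]].
  by rewrite inE => xt ->; rewrite limb_adjacent_hair // => E; exists x; rewrite ?inE ?xt.
rewrite inE => /andP[xt E] ->; rewrite limb_adjacent_hair // imset_f //.
by rewrite inE.
Qed.

Lemma hair_inj : injective hair.
Proof.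
move=> x x' [E _]; apply: (@desc_anti _ R).
  by rewrite -E desc_refl.
by rewrite E desc_refl.
Qed.

End Limbs.


Section PathRecognition.
Variable G : sgraph.

(** The neighbours of the i-th vertex of a path are its (i+1)-st and (i-1)-st. *)
Lemma path_degree (x : G) : is_path (whole G) -> degree x <= 2.
Proof.
case/existsP=> u /existsP[n /existsP[p /and3P[_ Up /eqP[_ E]]]].
pose s := u :: p; pose i := index x s.
apply: leq_trans (_ : #|[set nth u s i.+1; nth u s i.-1]| <= 2); last first.
  by rewrite cards2; case: (_ != _).
apply/subset_leq_card/subsetP=> y; rewrite inE => xy.
have : [set x; y] \in edges_in [set: G] by rewrite pair_in_edges !inE.
rewrite E => /imsetP[[a b] /(nthP (u, u))[j jlt ab] /set2_eq abE].
have jlt' : j < size (zip (u :: p) p) := jlt.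
move: ab; rewrite nth_zip_cond jlt' => -[aE bE].
rewrite size_zip /= size_tuple in jlt.
have {}jlt : j < size p.
  by rewrite size_tuple; apply: leq_trans jlt _; apply: geq_minr.
have {}bE : nth u s j.+1 = b by [].
case: abE => [] /= [xE yE].
  have -> : y = nth u s i.+1; last by rewrite !inE eqxx.
  by rewrite yE -bE /i xE -aE index_uniq //= ltnS ltnW.
have -> : y = nth u s i.-1; last by rewrite !inE eqxx orbT.
by rewrite yE -aE /i xE -bE index_uniq //= ltnS.
Qed.

(** If all degrees are at most 2, root the tree at a vertex of degree at most 1, such as a
    deepest vertex for another root: then no vertex has two children,
    and the whole tree is a path by [hair_path]. *)
Lemma not_path_branch : is_tree G -> ~~ is_path (whole G) -> exists x : G, 2 < degree x.
Proof.
move=> tG nP; have [/existsP//|/existsPn deg2] := boolP [exists x : G, 2 < degree x].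
case/negP: nP; have [/card_gt0P[r0 _] _ _] := tG.
have [R0 _] := tree_rooting r0 tG.
case: (arg_maxnP (P := xpredT) (i0 := r0) (rank R0) isT) => y _ ymax.
have [R RE] := tree_rooting y tG.
have y0 : children R0 y = set0.
  apply/setP=> z; rewrite !inE; apply/negP=> /andP[zr /eqP pz].
  by have := rank_parent zr; rewrite pz ltnNge (ymax z isT : _ <= _).
have yU : base R \in hairs R.
  apply/hairsP=> z _; have := deg2 z; rewrite -leqNgt.
  have [->|zr] := eqVneq z (base R); last by rewrite (degree_parent R) zr.
  move=> _; have := degree_parent R (base R); rewrite eqxx add0n => <-.
  by rewrite RE (degree_parent R0) y0 cards0 addn0 leq_b1.
apply/existsP; exists (base R); have := hair_path yU; rewrite /hair.
by have -> : desc R (base R) = setT by apply/setP=> z; rewrite desc_base inE.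
Qed.

End PathRecognition.

Import GRing.Theory.

(** * The generating function of the subtrees *)

Section Fibers.
Local Open Scope ring_scope.
Variables (T I : finType) (h : T -> I) (K : comPzSemiRingType).
Variables (P : I -> pred {set T}) (F : I -> {set T} -> K).

Let fib i := [set y | h y == i].

(** A set A amounts to the family of its traces on the fibres of h, so a condition
    and a weight that factor over the fibres can be summed fibre by fibre. *)
Lemma sum_fibers :
  \sum_(A : {set T} | [forall i, P i (A :&: fib i)]) \prod_i F i (A :&: fib i) =
  \prod_i \sum_(W : {set T} | (W \subset fib i) && P i W) F i W.
Proof.
rewrite bigA_distr_big_dep.
rewrite (reindex_onto (fun f : {ffun I -> {set T}} => [set y | y \in f (h y)])
           (fun A => [ffun i => A :&: fib i])) /=; last first.
  by move=> A _; apply/setP=> y; rewrite inE ffunE !inE eqxx andbT.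
have cut (f : {ffun I -> {set T}}) i : f i \subset fib i ->
    [set y | y \in f (h y)] :&: fib i = f i.
  move=> /subsetP sf; apply/setP=> y; rewrite !inE.
  apply/andP/idP => [[yf /eqP <-]//|yf].
  by have := sf y yf; rewrite /fib inE => /eqP E; rewrite E yf.
apply: eq_big => [f|f /andP[_ /eqP fE]].
  apply/andP/familyP => [[/forallP Pf /eqP fE] i|fam].
    have fi : f i = [set y in f (h y)] :&: fib i by rewrite -{1}fE ffunE.
    by rewrite unfold_in fi subsetIr Pf.
  have sub i : f i \subset fib i by have := fam i; rewrite unfold_in => /andP[].
  split; first by apply/forallP=> i; rewrite cut //; have := fam i; rewrite unfold_in => /andP[].
  by apply/eqP/ffunP=> i; rewrite ffunE cut.
by apply: eq_bigr => i _; rewrite -{2}fE ffunE.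
Qed.

End Fibers.

Local Definition setE := (in_set0, in_setI, in_setC, in_set1).

Section Generating.
Local Open Scope ring_scope.
Variables (G : sgraph) (R : rooting G).
Local Notation r := (base R).
Local Notation par := (parent R).
Local Notation children := (children R).
Local Notation desc := (desc R).
Local Notation hairs := (hairs R).
Local Notation hairtop := (hairtop R).
Local Notation attached := (attached R).
Hypothesis deg3 : (2 < degree r)%N.
Variables (K : comNzRingType) (z : K).

(** The generating function of the subpaths of a path on n vertices that contain a
    given end. *)
Definition runs n : K := \sum_(i < n) z ^+ i.+1.

Lemma runsS n : runs n.+1 = z + z * runs n.
Proof.
by rewrite /runs big_ord_recl expr1 mulr_sumr.
Qed.

Definition below x : K := \sum_(A | top_at R x A) z ^+ #|A|.

Lemma below_hair x : x \in hairs -> below x = runs #|desc x|.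
Proof.
elim/hair_ind=> {}x => [xU x0|c xU xc cU IH].
  rewrite (desc0 x0) cards1 /runs big_ord1 /below (big_pred1 [set x]) ?cards1 //.
  move=> A /=; apply/idP/eqP => [xA|->]; last exact: top_at_single.
  by apply: top_at_no_child xA _ => c; rewrite x0 inE.
have cx : c \in children x by rewrite xc set11.
have /andP[cr /eqP pc] : (c != r) && (par c == x) by move: cx; rewrite inE.
have xNc := child_desc cx.
rewrite (desc1 xc) cardsU1 xNc add1n runsS -IH /below (bigID (fun A : {set G} => c \in A)) /= addrC.
congr (_ + _).
  rewrite (big_pred1 [set x]) ?cards1 // => A /=.
  apply/andP/eqP => [[xA cA]|->].
    by apply: top_at_no_child xA _ => c'; rewrite xc inE => /eqP->.
  rewrite top_at_single inE; split=> //; apply: contraNneq xNc => <-.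
  exact: desc_refl.
have := sum_top_at_split (fun A : {set G} => z ^+ #|A|) cr; rewrite pc => ->.
rewrite (big_pred1 [set x]) => [|A /=]; last first.
  apply/andP/eqP => [[xA cA]|->].
    by apply: top_at_no_child xA _ => c'; rewrite xc inE => /eqP->.
  rewrite top_at_single inE; split=> //; apply: contraNneq xNc => <-.
  exact: desc_refl.
rewrite mulr_sumr; apply: eq_bigr => B /top_at_desc/subsetP BD.
rewrite cardsU1 exprD -/(#|_|) (_ : x \notin B) ?expr1 //.
by apply: contra xNc; apply: BD.
Qed.

(** The branches below the vertices of a path have orders 1, 2, ..., once each. *)
Lemma sum_desc_hair x (V : nmodType) (g : nat -> V) : x \in hairs ->
  \sum_(t in desc x) g #|desc t| = \sum_(i < #|desc x|) g i.+1.
Proof.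
elim/hair_ind=> {}x => [xU x0|c xU xc cU IH].
  have cardE : #|desc x| = 1%N by rewrite desc0 ?cards1.
  by rewrite cardE big_ord1 (desc0 x0) big_set1 cardE.
have xNc : x \notin desc c by apply: child_desc; rewrite xc set11.
have cardE : #|desc x| = #|desc c|.+1 by rewrite (desc1 xc) cardsU1 xNc.
rewrite {1}(desc1 xc) big_setU1 // IH cardE big_ord_recr /= addrC.
by rewrite -cardE.
Qed.

(** Sends a limb vertex to the top of its limb and fixes the core, so that the fibres
    are the limbs and the single core vertices. *)
Definition hroot y : G := odflt y [pick x | hairtop x && (y \in desc x)].

Lemma hroot_hair y : y \in hairs -> hairtop (hroot y) && (y \in desc (hroot y)).
Proof.
move=> /(hairtop_desc deg3)[x xt yx]; rewrite /hroot.
by case: pickP => [//|/(_ x)]; rewrite xt yx.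
Qed.

Lemma hroot_core y : y \notin hairs -> hroot y = y.
Proof.
move=> yN; rewrite /hroot; case: pickP => //= x /andP[/andP[xU _] yx].
by rewrite (hairs_desc xU yx) in yN.
Qed.

Lemma hroot_desc x : hairtop x -> [set y | hroot y == x] = desc x.
Proof.
move=> xt; have /andP[xU _] := xt; apply/setP=> y; rewrite in_set.
apply/eqP/idP => [E|yx].
  have [/hroot_hair/andP[_]|yN] := boolP (y \in hairs); first by rewrite E.
  by rewrite -E hroot_core // desc_refl.
have /andP[yt yy] := hroot_hair (hairs_desc xU yx).
exact: hairtop_uniq yt xt yy yx.
Qed.

Lemma hroot_nottop x : x \in hairs -> ~~ hairtop x -> [set y | hroot y == x] = set0.
Proof.
move=> xU nt; apply/setP=> y; rewrite !inE; apply: contraNF nt => /eqP yx.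
have [/hroot_hair|yN] := boolP (y \in hairs); first by rewrite yx => /andP[].
by rewrite -yx hroot_core // (negbTE yN) in xU.
Qed.

Let fib i := [set y | hroot y == i].

Lemma hroot_fiber_core i : i \notin hairs -> fib i = [set i].
Proof.
move=> iN; apply/setP=> y; rewrite !inE; apply/eqP/eqP => [yi|->]; last exact: hroot_core.
have [/hroot_hair|yN] := boolP (y \in hairs); last by rewrite -yi hroot_core.
by rewrite yi => /andP[/andP[]]; rewrite (negbTE iN).
Qed.

Variable S : {set G}.
Hypothesis core_S : S \subset ~: hairs.

Definition closed_hairs (A : {set G}) : bool := [forall y in A :&: hairs, par y \in A].

(** What a subtree with trace S on the core may look like on one fibre of [hroot]: on
    a limb it is empty or an initial segment from the top, the latter only if the
    limb hangs from S. *)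
Definition trace_ok (i : G) : pred {set G} := fun W =>
  if i \in hairs then (W == set0) || top_at R i W && (par i \in S)
  else W == [set i] :&: S.

Lemma trace_okE A : (A :&: ~: hairs == S) && closed_hairs A =
  [forall i, trace_ok i (A :&: fib i)].
Proof.
apply/andP/forallP => [[/eqP AS /forall_inP clA] i|ok].
  rewrite /trace_ok; case: ifPn => [iU|iN]; last first.
    rewrite hroot_fiber_core // -AS; apply/eqP/setP=> y; rewrite !setE.
    by have [->|] := eqVneq y i; rewrite ?andbF // iN andbT.
  have [it|nt] := boolP (hairtop i); last by rewrite /fib hroot_nottop // setI0 eqxx.
  rewrite /fib hroot_desc //; have [//|/set0Pn[y0 y0W] /=] := eqVneq.
  have up y : y \in A :&: desc i -> y != i -> par y \in A :&: desc i.
    rewrite in_setI => /andP[yA yi] y_i; rewrite in_setI desc_up // andbT clA //.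
    by rewrite setE yA (hairs_desc iU).
  have iA : i \in A.
    elim/(rank_ind (R := R)): y0 y0W => y IH yW.
    have [yi|y_i] := eqVneq y i; first by move: yW; rewrite yi in_setI => /andP[].
    apply: IH (up y yW y_i); apply: hairs_base => //; apply: hairs_desc iU _.
    by move: yW; rewrite in_setI => /andP[].
  apply/andP; split.
    apply/top_atP; split; first by rewrite in_setI iA desc_refl.
    move=> x xW x_i; split; last exact: up.
    apply: hairs_base => //; apply: hairs_desc iU _.
    by move: xW; rewrite in_setI => /andP[].
  rewrite -AS in_setI setE; case/andP: it => _ ->; rewrite andbT clA //.
  by rewrite setE iA.
have AS y : y \notin hairs -> (y \in A) = (y \in S).
  move=> yN; have := ok y; rewrite /trace_ok (negbTE yN) hroot_fiber_core //.
  by move/eqP/setP/(_ y); rewrite !setE eqxx andbT.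
split.
  apply/eqP/setP=> y; rewrite !setE; have [yU|yN] := boolP (y \in hairs); last by rewrite AS ?andbT.
  by rewrite andbF; apply/esym/negP=> /(subsetP core_S); rewrite setE yU.
apply/forall_inP=> y; rewrite setE => /andP[yA yU].
have /andP[it yi] := hroot_hair yU; have /andP[iU iN] := it.
have := ok (hroot y); rewrite /trace_ok iU /fib hroot_desc // => /orP[/eqP/setP/(_ y)|].
  by rewrite in_setI yA yi setE.
case/andP=> /top_atP[_ H] piS.
have [yE|y_i] := eqVneq y (hroot y); first by rewrite yE AS.
have [_] : y != r /\ par y \in A :&: desc (hroot y) by apply: H => //; rewrite in_setI yA.
by rewrite in_setI => /andP[].
Qed.

(** With the trace S on the core fixed, the choices on the limbs at S are
    independent. *)
Lemma sum_over_core :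
  \sum_(A | (A :&: ~: hairs == S) && closed_hairs A) z ^+ #|A| =
  \prod_(v in S) (z * \prod_(x in attached v) (1 + runs #|desc x|)).
Proof.
rewrite (eq_bigl _ _ trace_okE).
transitivity (\sum_(A | [forall i, trace_ok i (A :&: fib i)]) \prod_i z ^+ #|A :&: fib i|).
  apply: eq_bigr => A _; rewrite prodrXr; congr (_ ^+ _).
  rewrite -sum1_card (partition_big hroot xpredT) //=; apply: eq_bigr => i _.
  by rewrite -sum1_card; apply: eq_bigl => y; rewrite in_setI in_set.
rewrite (sum_fibers hroot trace_ok (fun i (W : {set G}) => z ^+ #|W|)).
transitivity (\prod_i ((if i \in S then z else 1) *
   (if hairtop i && (par i \in S) then 1 + runs #|desc i| else 1))).
  apply: eq_bigr => i _; rewrite -/(fib i); have [iU|iN] := boolP (i \in hairs); last first.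
    rewrite /hairtop (negbTE iN) mulr1 (big_pred1 ([set i] :&: S)) => [|W].
      case: ifPn => iS; first by rewrite (setIidPl _) ?cards1 ?sub1set.
      by rewrite (_ : _ :&: _ = set0) ?cards0 //; apply/disjoint_setI0; rewrite disjoints1.
    rewrite /trace_ok (negbTE iN) hroot_fiber_core //=.
    by apply/andP/eqP => [[_ /eqP]//|->]; rewrite subsetIl.
  have /negbTE-> : i \notin S by apply: contraTN iU => /(subsetP core_S); rewrite setE.
  rewrite mul1r; have [it|nt] := boolP (hairtop i); last first.
    rewrite (big_pred1 set0) ?cards0 // => W; rewrite /fib hroot_nottop // subset0 /=.
    by rewrite /trace_ok iU; case: eqP.
  rewrite /fib hroot_desc // -below_hair //= (bigD1 set0) /=; last first.
    by rewrite sub0set /trace_ok iU eqxx.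
  rewrite cards0; case: ifPn => piS; last first.
    rewrite big1 ?addr0 // => W /andP[/andP[_]].
    by rewrite /trace_ok iU (negbTE piS) andbF orbF => ->.
  congr (_ + _); apply: eq_bigl => W; rewrite /trace_ok iU piS andbT.
  apply/andP/idP => [[/andP[_ /orP[->//|//]]]|tW].
  rewrite tW orbT andbT (top_at_desc tW); split=> //.
  by apply/set0Pn; exists i; case/andP: tW.
rewrite big_split /= -!big_mkcond big_split; congr (_ * _).
rewrite [LHS](partition_big par (mem S)) /= => [|x /andP[_ xS]] //.
apply: eq_bigr => v vS; apply: eq_bigl => x; rewrite in_set.
by case: eqP => [->|]; rewrite ?vS ?andbT ?andbF.
Qed.

End Generating.

Section Total.
Local Open Scope ring_scope.
Variables (G : sgraph) (R : rooting G).
Hypothesis deg3 : (2 < degree (base R))%N.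
Variables (K : comNzRingType) (z : K).
Local Notation par := (parent R).
Local Notation hairs := (hairs R).

Lemma top_at_core t (A : {set G}) : t \notin hairs ->
  top_at R t A = top_at R t (A :&: ~: hairs) && closed_hairs R A.
Proof.
move=> tN; apply/idP/andP => [/top_atP[tA H]|[/top_atP[tS H] /forall_inP cl]].
  split.
    apply/top_atP; split=> [|x]; rewrite !setE ?tA // => /andP[xA xN] xt.
    by have [-> ->] := H x xA xt; rewrite parent_notin_hairs.
  apply/forall_inP=> y; rewrite setE => /andP[yA yU].
  by have [] := H y yA (contraNneq (fun E => etrans (congr1 _ (esym E)) yU) tN).
have tA : t \in A by move: tS; rewrite setE => /andP[].
apply/top_atP; split=> // x xA xt; have [xU|xN] := boolP (x \in hairs).
  by split; [apply: hairs_base|apply: cl; rewrite setE xA].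
have xS : x \in A :&: ~: hairs by rewrite !setE xA.
have [-> ] := H x xS xt.
by rewrite setE => /andP[].
Qed.

(** The two terms collect the subtrees whose top is in the core and those whose
    top is in a limb. *)
Lemma sum_tree_sets :
  \sum_(A : {set G} | tree_set A) z ^+ #|A| =
  \sum_(S : {set G} | (S \subset ~: hairs) && tree_set S)
     \prod_(v in S) (z * \prod_(x in attached R v) (1 + runs z #|desc R x|)) +
  \sum_(v in ~: hairs) \sum_(x in attached R v) \sum_(i < #|desc R x|) runs z i.+1.
Proof.
rewrite (sum_tree_set R) (bigID (mem (~: hairs))) /=; congr (_ + _).
  rewrite [RHS]big_mkcondl (sum_tree_set R).
  rewrite [RHS](bigID (mem (~: hairs))) /= addrC [X in _ = X + _]big1 ?add0r; last first.
    move=> t; rewrite setE negbK => tU; rewrite -big_mkcondr /= big_pred0 // => S.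
    apply/andP=> [[/andP[tS _] /subsetP/(_ t tS)]]; by rewrite setE tU.
  apply: eq_bigr => t; rewrite setE => tN; rewrite -big_mkcondr /=.
  rewrite (partition_big (fun A => A :&: ~: hairs)
     (fun S => top_at R t S && (S \subset ~: hairs))) /=; last first.
    by move=> A; rewrite top_at_core // => /andP[->]; rewrite subsetIr.
  apply: eq_bigr => S /andP[tS Ssub]; rewrite -(sum_over_core deg3 z Ssub).
  apply: eq_bigl => A; rewrite top_at_core //.
  by case: eqP => [->|]; rewrite ?andbF // tS andbT.
rewrite (eq_bigl (mem hairs)) => [|x]; last by rewrite /= setE negbK.
rewrite (partition_big (hroot R) (hairtop R)) /= => [|x /(hroot_hair deg3)/andP[]//].
rewrite (partition_big par (mem (~: hairs))) /= => [|x /andP[_]]; last by rewrite setE.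
apply: eq_bigr => v vN; apply: eq_big => [x|x /andP[xt _]]; first by rewrite in_set.
have /andP[xU _] := xt.
rewrite -(sum_desc_hair _ xU); apply: eq_big => [y|y /andP[yU _]]; last exact: below_hair.
rewrite -(hroot_desc deg3 xt) in_set; case: eqP => [yx|]; rewrite ?andbF ?andbT //.
by have := hairs_desc xU (_ : y \in desc R x); rewrite -hroot_desc // in_set yx eqxx => ->.
Qed.

End Total.

Import Order.TTheory Num.Theory.

(** * The local mean is at least the global mean *)

Lemma big_setU_disj (V : Type) (idx : V) (op : Monoid.com_law idx) (T : finType)
    (A B : {set T}) (F : T -> V) : [disjoint A & B] ->
  \big[op/idx]_(x in A :|: B) F x =
  op (\big[op/idx]_(x in A) F x) (\big[op/idx]_(x in B) F x).
Proof. by move=> AB; rewrite -bigU //; apply: eq_bigl => x; rewrite !inE. Qed.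

(** Here each v carries a multiplicity p v, the number of ways to extend a subtree into
    the limbs at v, and a mean contribution a v to the order; b v and e v are the number
    and the total order of the subtrees inside the limbs at v. *)
Section LocalMean.
Local Open Scope ring_scope.
Variables (H : sgraph) (treeH : is_tree H).
Variables (F : realFieldType) (p a b e : H -> F).
Hypothesis a_ge1 : forall v, 1 <= a v.
Hypothesis a_le_p : forall v, a v <= p v.
Hypothesis b_ge0 : forall v, 0 <= b v.
Hypothesis e_le : forall v, e v <= a v * b v.

Definition prod_on (A : {set H}) : F := \prod_(v in A) p v.
Definition sum_on (A : {set H}) : F := \sum_(v in A) a v.

Let a_ge0 v : 0 <= a v.
Proof. exact: le_trans ler01 (a_ge1 v). Qed.

Let p_gt0 v : 0 < p v.
Proof. exact: lt_le_trans ltr01 (le_trans (a_ge1 v) (a_le_p v)). Qed.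

Let p_ge1 v : 1 <= p v.
Proof. exact: le_trans (a_ge1 v) (a_le_p v). Qed.

Let prod_on_gt0 A : 0 < prod_on A.
Proof. by apply: prodr_gt0 => v _. Qed.

Let prod_on_ge (A : {set H}) v : v \in A -> p v <= prod_on A.
Proof.
move=> vA; rewrite /prod_on (bigD1 v) //= ler_peMr ?(ltW (p_gt0 v)) //.
by elim/big_ind: _ => // x y x1 y1; rewrite mulr_ege1.
Qed.

Let sum_on_ge (A : {set H}) v : v \in A -> a v <= sum_on A.
Proof. by move=> vA; rewrite /sum_on (bigD1 v) //= lerDl sumr_ge0. Qed.

Section Rooted.
Variable R : rooting H.
Local Notation par := (parent R).

Let Q u : F := \sum_(A | top_at R u A) prod_on A.
Let M u : F := \sum_(A | top_at R u A) prod_on A * sum_on A.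

Let Q_gt0 u : 0 < Q u.
Proof.
rewrite /Q (bigD1 [set u]) ?top_at_single //= ltr_wpDr // sumr_ge0 // => A _.
exact: ltW.
Qed.

Let anc u x : {set H} := [set y in desc R u | x \in desc R y].

Let ancE u x y : (y \in anc u x) = (y \in desc R u) && (x \in desc R y).
Proof. exact: in_set. Qed.

Let top_anc u x : x \in desc R u -> top_at R u (anc u x).
Proof.
move=> xu; apply/top_atP; rewrite ancE desc_refl; split=> // y.
rewrite !ancE => /andP[yu xy] y_u; split.
  by apply: contraNneq y_u => yE; move: yu; rewrite yE => /desc_of_base->.
by rewrite desc_up //=; apply: desc_trans xy _; apply/desc_down/desc_refl.
Qed.

Let anc_inj u : {in desc R u &, injective (anc u)}.
Proof.
move=> x x' xu x'u E; apply: (@desc_anti _ R).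
  have: x' \in anc u x' by rewrite ancE x'u desc_refl.
  by rewrite -E ancE => /andP[].
have: x \in anc u x by rewrite ancE xu desc_refl.
by rewrite E ancE => /andP[].
Qed.

(** The path from u to a vertex x of A is itself a subtree with top u, of weight at least
    p x >= a x, and different vertices give different paths. *)
Let sum_on_le_Q u A : top_at R u A -> sum_on A <= Q u.
Proof.
move=> /top_at_desc/subsetP Au.
apply: le_trans (_ : \sum_(x in desc R u) p x <= _).
  rewrite /sum_on big_mkcond [leRHS]big_mkcond; apply: ler_sum => x _.
  case: ifP => [/Au->|_]; first exact: a_le_p.
  by case: ifP => // _; apply: ltW.
apply: le_trans (_ : \sum_(x in desc R u) prod_on (anc u x) <= _).
  by apply: ler_sum => x xu; apply: prod_on_ge; rewrite ancE xu desc_refl.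
rewrite -(big_imset _ (@anc_inj u)) /= /Q big_mkcond [leRHS]big_mkcond.
apply: ler_sum => B _; case: ifP => [/imsetP[x xu ->]|_]; first by rewrite top_anc.
by case: ifP => // _; apply: ltW.
Qed.

Let M_ge u : a u * Q u <= M u.
Proof.
rewrite /Q mulr_sumr; apply: ler_sum => A /andP[uA _].
by rewrite mulrC ler_pM2l // sum_on_ge.
Qed.

Let M_le u : M u <= Q u * Q u.
Proof.
by rewrite {1}/Q mulr_suml; apply: ler_sum => A uA; rewrite ler_pM2l // sum_on_le_Q.
Qed.

(** Let Q' and M' be the number and the total order of the subtrees with top par u
    that avoid u. By the splitting bijection the claim is
    Q' * M u <= M' * (1 + Q u) * Q u, which follows from Q' <= M' and
    M u <= Q u * Q u. *)
Let mean_step u : u != base R -> M u / Q u <= M (par u) / Q (par u).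
Proof.
move=> ur; have pN := parent_notin_desc ur.
rewrite ler_pdivrMr // mulrAC ler_pdivlMr //.
pose Q' := \sum_(A | top_at R (par u) A && (u \notin A)) prod_on A.
pose M' := \sum_(A | top_at R (par u) A && (u \notin A)) prod_on A * sum_on A.
have disj (A B : {set H}) : top_at R (par u) A && (u \notin A) -> top_at R u B ->
    [disjoint A & B].
  move=> /andP[topA uA] /top_at_desc/subsetP BD.
  apply/pred0P => x /=; apply: contraNF uA => /andP[xA xB].
  exact: top_at_ancestor topA xA (BD x xB) pN.
have QE : Q (par u) = Q' * (1 + Q u).
  rewrite /Q (bigID (fun A : {set H} => u \in A)) /= sum_top_at_split // -/Q' addrC.
  rewrite mulrDr mulr1; congr (_ + _); rewrite mulr_suml; apply: eq_bigr => A topA.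
  rewrite mulr_sumr; apply: eq_bigr => B topB.
  by rewrite /prod_on big_setU_disj ?disj.
have ME : M (par u) = M' * (1 + Q u) + Q' * M u.
  rewrite /M (bigID (fun A : {set H} => u \in A)) /= sum_top_at_split // -/M' addrC.
  rewrite mulrDr mulr1 -addrA; congr (_ + _).
  rewrite !big_distrlr -big_split /=; apply: eq_bigr => A topA.
  rewrite -big_split /=; apply: eq_bigr => B topB.
  rewrite /prod_on /sum_on !big_setU_disj ?disj //=; ring.
have Q'M' : Q' <= M'.
  apply: ler_sum => A /andP[/andP[pA _] _]; rewrite ler_peMr ?(ltW (prod_on_gt0 _)) //.
  exact: le_trans (a_ge1 _) (sum_on_ge pA).
have Q'_ge0 : 0 <= Q' by apply: sumr_ge0 => A _; apply: ltW.
rewrite QE ME; have := M_le u; have := Q_gt0 u => q0 mle.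
have M0 : 0 <= M u by apply: sumr_ge0 => A _; apply: mulr_ge0; [apply: ltW|apply: sumr_ge0].
have h1 : Q' * M u <= M' * (Q u * Q u) by apply: ler_pM.
have h2 : 0 <= M' * Q u by apply: mulr_ge0; [apply: le_trans Q'_ge0 Q'M'|apply: ltW].
nra.
Qed.

(** Along the path to the base the means of the subtrees with a given top do not decrease, so
    all of them are at most the mean at the base; subtrees inside limbs at u have mean
    at most a u, hence at most the mean at top u. *)
Lemma rooted_local_mean :
  \sum_(A : {set H} | tree_set A) prod_on A * sum_on A + \sum_v e v <=
  M (base R) / Q (base R) * (\sum_(A : {set H} | tree_set A) prod_on A + \sum_v b v).
Proof.
pose c := M (base R) / Q (base R).
have le_c u : M u / Q u <= c.
  elim/(rank_ind (R := R)): u => u IH.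
  have [->//|ur] := eqVneq u (base R); exact: le_trans (mean_step ur) (IH ur).
rewrite !(sum_tree_set R) mulrDr; apply: lerD; rewrite mulr_sumr; apply: ler_sum => u _.
  by rewrite -/(M u) -/(Q u) -ler_pdivrMr ?le_c.
apply: le_trans (e_le u) _; apply: ler_wpM2r => //; apply: le_trans (le_c u).
by rewrite ler_pdivlMr.
Qed.

End Rooted.

(** When the tree is rooted at v, the subtrees with top v are those that contain v. *)
Lemma local_mean v :
  let Q := \sum_(A : {set H} | tree_set A && (v \in A)) prod_on A in
  let M := \sum_(A : {set H} | tree_set A && (v \in A)) prod_on A * sum_on A in
  [/\ p v <= Q, a v * Q <= M &
  \sum_(A : {set H} | tree_set A) prod_on A * sum_on A + \sum_v e v <=
  M / Q * (\sum_(A : {set H} | tree_set A) prod_on A + \sum_v b v)].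
Proof.
have [R RE] := tree_rooting v treeH.
have top (A : {set H}) : tree_set A && (v \in A) = top_at R v A.
  rewrite (tree_setE R); apply/andP/idP => [[/existsP[t tA] vA]|vA]; last first.
    by split; [apply/existsP; exists v|case/andP: vA].
  have := desc_base R t; have := subsetP (top_at_desc tA) v vA.
  by rewrite RE => h1 h2; rewrite -(desc_anti h2 h1).
move=> Q M; split.
- rewrite /Q (bigD1 [set v]) /=; last by rewrite top top_at_single.
  by rewrite /prod_on big_set1 lerDl sumr_ge0 // => A _; apply: ltW; apply: prod_on_gt0.
- rewrite /Q mulr_sumr; apply: ler_sum => A /andP[_ vA].
  by rewrite mulrC ler_pM2l // sum_on_ge.
by rewrite /M /Q !(eq_bigl _ _ top) -RE; apply: rooted_local_mean.
Qed.

End LocalMean.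

(** * Balancing limb orders *)

Section BalancedLists.

Definition balanced (s : seq nat) : bool := allrel (fun x y => x <= y + 1) s s.

Lemma balancedP s : reflect {in s &, forall x y, x <= y + 1} (balanced s).
Proof. exact: allrelP. Qed.

Lemma perm_two_values q s : all (pred2 q q.+1) s ->
  perm_eq s (nseq (count_mem q s) q ++ nseq (count_mem q.+1 s) q.+1).
Proof.
elim: s => //= x s IHs /andP[/orP[/eqP->|/eqP->] /IHs {}IHs].
  by rewrite eqxx (_ : (q == q.+1) = false) ?perm_cons //; lia.
rewrite eqxx (_ : (q.+1 == q) = false) /=; last by lia.
by rewrite perm_sym (perm_catCA _ [:: q.+1]) perm_cons perm_sym.
Qed.

Lemma sumn_two_values q s : all (pred2 q q.+1) s ->
  sumn s = size s * q + count_mem q.+1 s /\ size s = count_mem q s + count_mem q.+1 s.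
Proof.
elim: s => //= x s IHs /andP[/orP[/eqP->|/eqP->] /IHs[-> E]].
  by rewrite eqxx (_ : (q == q.+1) = false); lia.
by rewrite eqxx (_ : (q.+1 == q) = false); lia.
Qed.

(** With q the least entry, all entries are q or q + 1, and q + 1 occurs fewer than
    size s times; so q is the quotient of the sum by the length. *)
Lemma balanced_values s : balanced s -> 0 < size s ->
  all (pred2 (sumn s %/ size s) (sumn s %/ size s).+1) s.
Proof.
move=> /balancedP bal s0.
have ex : exists q, q \in s by case: s s0 {bal} => // x s _; exists x; rewrite mem_head.
case: (ex_minnP ex) => q qs qmin.
have vals : all (pred2 q q.+1) s.
  by apply/allP=> x xs /=; have := bal x q xs qs; have := qmin x xs; lia.
have [E1 E2] := sumn_two_values vals.
have cq : 0 < count_mem q s by rewrite -has_count has_pred1.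
suff -> : sumn s %/ size s = q by [].
by rewrite E1 mulnC divnMDl // divn_small ?addn0 //; lia.
Qed.

Lemma balanced_perm s t : balanced s -> balanced t -> size s = size t ->
  sumn s = sumn t -> perm_eq s t.
Proof.
move=> bs bt sz sm; have [s0|] := ltnP 0 (size s); last first.
  by rewrite leqn0 => /eqP/size0nil s0; move: sz; rewrite s0 => /esym/size0nil->.
have vs := balanced_values bs s0; have vt : all _ t := balanced_values bt _.
rewrite -sz -sm in vt; have {}vt := vt s0.
apply: perm_trans (perm_two_values vs) _; rewrite perm_sym.
apply: perm_trans (perm_two_values vt) _.
have [E1 E2] := sumn_two_values vs; have [E3 E4] := sumn_two_values vt.
suff [-> ->] : count_mem (sumn s %/ size s) t = count_mem (sumn s %/ size s) s /\
   count_mem (sumn s %/ size s).+1 t = count_mem (sumn s %/ size s).+1 s by [].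
move: E1 E2 E3 E4; rewrite -sz -sm; move: (_ %/ _) => q.
move: (_ * q) (count_mem q s) (count_mem q.+1 s) (count_mem q t) (count_mem q.+1 t).
move=> N c1 c2 c3 c4 E1 E2 E3 E4; have E : c2 = c4 by lia.
by have E5 := etrans (esym E2) E4; split; lia.
Qed.

Lemma unbalanced_split s : ~~ balanced s ->
  exists y k s', perm_eq s [:: y + k.+2, y & s'].
Proof.
case/allPn=> x xs /allPn[y ys lt].
have {}ys : y \in rem x s.
  by move: ys; rewrite (perm_mem (perm_to_rem xs)) inE => /orP[/eqP E|//]; lia.
exists y, (x - y - 2), (rem y (rem x s)).
have -> : y + (x - y - 2).+2 = x by lia.
by apply: perm_trans (perm_to_rem xs) _; rewrite perm_cons perm_to_rem.
Qed.

End BalancedLists.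

Section Optimization.
Local Open Scope ring_scope.

(** The number of ways to choose an initial segment, possibly empty, of each limb. *)
Definition portions (s : seq nat) : rat := \prod_(l <- s) l.+1%:R.
(** The average contribution of a vertex and of the initial segments of its limbs to
    the order of a subtree. *)
Definition portion_mean (s : seq nat) : rat := 1 + \sum_(l <- s) l%:R / 2.
(** Number of the subpaths of the limbs. *)
Definition inner_count (s : seq nat) : rat := \sum_(l <- s) l%:R * l.+1%:R / 2.
(** Sum of the orders of the subpaths of the limbs. *)
Definition inner_order (s : seq nat) : rat :=
  \sum_(l <- s) l%:R * l.+1%:R * l.+2%:R / 6.

Lemma portions_perm s t : perm_eq s t -> portions s = portions t.
Proof. exact: perm_big. Qed.

Lemma portion_mean_perm s t : perm_eq s t -> portion_mean s = portion_mean t.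
Proof. by move=> st; congr (_ + _); apply: perm_big. Qed.

Lemma inner_count_perm s t : perm_eq s t -> inner_count s = inner_count t.
Proof. exact: perm_big. Qed.

Lemma inner_order_perm s t : perm_eq s t -> inner_order s = inner_order t.
Proof. exact: perm_big. Qed.

Variables (H : sgraph) (treeH : is_tree H).
Implicit Type l : H -> seq nat.

Definition subtree_count l : rat :=
  \sum_(A : {set H} | tree_set A) prod_on (portions \o l) A + \sum_v inner_count (l v).
Definition subtree_order l : rat :=
  \sum_(A : {set H} | tree_set A)
     prod_on (portions \o l) A * sum_on (portion_mean \o l) A + \sum_v inner_order (l v).

Lemma portion_mean_ge1 s : 1 <= portion_mean s.
Proof. by rewrite lerDl sumr_ge0 // => i _; rewrite divr_ge0. Qed.

Lemma portions_ge s : portion_mean s <= portions s.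
Proof.
rewrite /portions /portion_mean; elim: s => [|x s IHs]; rewrite ?(big_nil, big_cons) ?addr0 //.
have := portion_mean_ge1 s; rewrite /portion_mean; set S := \sum_(_ <- s) _ in IHs *.
set P := \prod_(_ <- s) _ in IHs *.
have := ler0n rat x; rewrite -[x.+1%:R]natr1; move: (x%:R : rat) => X X0 S0.
have : 0 <= X * (P - 1) by apply: mulr_ge0; lra.
lra.
Qed.

Lemma inner_count_ge0 s : 0 <= inner_count s.
Proof. by apply: sumr_ge0 => i _; rewrite divr_ge0 // mulr_ge0. Qed.

Lemma inner_order_le s : inner_order s <= portion_mean s * inner_count s.
Proof.
rewrite mulr_sumr /inner_order big_seq [leRHS]big_seq; apply: ler_sum => i si.
have : (i%:R / 2 : rat) <= \sum_(l <- s) l%:R / 2.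
  by rewrite (big_rem i) //= lerDl sumr_ge0 // => j _; rewrite divr_ge0.
rewrite /portion_mean; set S := \sum_(_ <- _) _.
have i1 : i.+1%:R = i%:R + 1 :> rat by rewrite natr1.
have i2 : i.+2%:R = i%:R + 2 :> rat by rewrite -addn2 natrD.
have := ler0n rat i; rewrite i1 i2; move: (i%:R : rat) => X X0 XS.
have : 0 <= X * (X + 1) * (1 + S - (X + 2) / 3).
  by apply: mulr_ge0; [apply: mulr_ge0|]; lra.
lra.
Qed.

Lemma prod_on_gt0 l A : 0 < prod_on (portions \o l) A.
Proof.
apply: prodr_gt0 => v _ /=; apply: lt_le_trans (portions_ge _).
exact: lt_le_trans (portion_mean_ge1 _).
Qed.

Lemma subtree_count_gt0 l : 0 < subtree_count l.
Proof.
have [/card_gt0P[v _] _ _] := treeH.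
have [R RE] := tree_rooting v treeH.
rewrite /subtree_count ltr_wpDr ?sumr_ge0 // => [u _|]; first exact: inner_count_ge0.
rewrite (bigD1 [set v]) /=; last first.
  by rewrite (tree_setE R); apply/existsP; exists v; apply: top_at_single.
by rewrite ltr_wpDr ?prod_on_gt0 // sumr_ge0 // => A _; apply/ltW/prod_on_gt0.
Qed.

(** The move gains subtrees through v whose mean c is at least the global mean, and loses
    at most as many subtrees, of mean at most c. *)
Lemma balance_step l l' v y k s :
  perm_eq (l v) [:: (y + k.+2)%N, y & s] ->
  perm_eq (l' v) [:: (y + k.+1)%N, y.+1 & s] ->
  (forall u, u != v -> l' u = l u) ->
  subtree_order l / subtree_count l <= subtree_order l' / subtree_count l'.
Proof.
move=> lv l'v l'E.
have [] := @local_mean _ treeH _ (portions \o l) (portion_mean \o l)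
  (inner_count \o l) (inner_order \o l) (fun u => portion_mean_ge1 _)
  (fun u => portions_ge _) (fun u => inner_count_ge0 _) (fun u => inner_order_le _) v.
rewrite -/(subtree_count l) -/(subtree_order l).
set Q := \sum_(A | _) prod_on _ A; set M := \sum_(A | _) _ => Qge Mge Tle.
(* The two orders at v are X and Y, and d = X - Y - 1; q accounts for the other
   limbs at v. *)
pose d : rat := k.+1%:R.
pose X : rat := (y + k.+2)%:R; pose Y : rat := y%:R.
have XE : X = Y + d + 1.
  by rewrite /X (_ : (y + k.+2 = y + k.+1 + 1)%N) ?natrD //; lia.
have succ n i : (n + i)%:R = n%:R + i%:R :> rat by rewrite natrD.
have x1 : (y + k.+2).+1%:R = X + 1 by rewrite -addn1 succ.
have x2 : (y + k.+2).+2%:R = X + 2 by rewrite -addn2 succ.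
have y1 : y.+1%:R = Y + 1 by rewrite -addn1 succ.
have y2 : y.+2%:R = Y + 2 by rewrite -addn2 succ.
have y3 : y.+3%:R = Y + 3 by rewrite -addn3 succ.
have x'0 : (y + k.+1)%:R = X - 1 by rewrite succ XE -/Y -/d; ring.
have x'1 : (y + k.+1).+1%:R = X by rewrite -addn1 succ x'0; ring.
have x'2 : (y + k.+1).+2%:R = X + 1 by rewrite -addn2 succ x'0; ring.
have Y0 : 0 <= Y by apply: ler0n.
have d1 : 1 <= d by rewrite ler1n.
pose q := portions s.
have q1 : 1 <= q by apply: le_trans (portions_ge s); apply: portion_mean_ge1.
have pE : portions (l v) = (X + 1) * (Y + 1) * q.
  by rewrite (portions_perm lv) /portions !big_cons x1 y1 mulrA.
have p'E : portions (l' v) = X * (Y + 2) * q.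
  by rewrite (portions_perm l'v) /portions !big_cons x'1 y2 mulrA.
have aE u : portion_mean (l' u) = portion_mean (l u).
  have [->|/l'E->//] := eqVneq u v.
  rewrite (portion_mean_perm lv) (portion_mean_perm l'v) /portion_mean.
  by rewrite !big_cons x'0 y1 -/X -/Y; field.
have restE (f : seq nat -> rat) :
    \sum_(u | u != v) f (l' u) = \sum_(u | u != v) f (l u).
  by apply: eq_bigr => u /l'E->.
have bE : \sum_u inner_count (l' u) = \sum_u inner_count (l u) - d.
  rewrite (bigD1 v) //= [in RHS](bigD1 v) //= restE.
  rewrite (inner_count_perm lv) (inner_count_perm l'v) /inner_count !big_cons.
  by rewrite x'0 x'1 y1 y2 x1 -/X -/Y XE; field.
have eE : \sum_u inner_order (l' u) = \sum_u inner_order (l u) - d * (1 + (X + Y) / 2).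
  rewrite (bigD1 v) //= [in RHS](bigD1 v) //= restE.
  rewrite (inner_order_perm lv) (inner_order_perm l'v) /inner_order !big_cons.
  by rewrite x'0 x'1 x'2 y1 y2 y3 x1 x2 -/X -/Y XE; field.
have am : 1 + (X + Y) / 2 <= portion_mean (l v).
  rewrite (portion_mean_perm lv) /portion_mean !big_cons -/X -/Y.
  have : 0 <= \sum_(j <- s) j%:R / 2 :> rat by apply: sumr_ge0 => j _; rewrite divr_ge0.
  lra.
have P1_neq0 : (X + 1) * (Y + 1) != 0 by apply: lt0r_neq0; nra.
(* The products over sets containing v are multiplied by 1 + kap. *)
pose kap := d / ((X + 1) * (Y + 1)).
have prod_onE (A : {set H}) : prod_on (portions \o l') A =
    prod_on (portions \o l) A + (if v \in A then kap * prod_on (portions \o l) A else 0).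
  rewrite /prod_on; case: ifP => vA; last first.
    rewrite addr0; apply: eq_bigr => u uA /=; rewrite l'E //.
    by apply: contraFneq vA => <-.
  rewrite (bigD1 v) //= [in RHS](bigD1 v) //= pE p'E.
  rewrite (eq_bigr (portions \o l)) => [|u /andP[_ /l'E->//]].
  have -> : kap = (X - Y - 1) / ((X + 1) * (Y + 1)) by rewrite /kap XE; congr (_ / _); ring.
  by field; apply/andP; split; apply: lt0r_neq0; lra.
have countE : subtree_count l' = subtree_count l + (kap * Q - d).
  rewrite /subtree_count bE (eq_bigr _ (fun A _ => prod_onE A)) big_split /= -big_mkcondr.
  by rewrite -mulr_sumr -/Q; ring.
have orderE : subtree_order l' = subtree_order l + (kap * M - d * (1 + (X + Y) / 2)).
  have sum_onE (A : {set H}) : sum_on (portion_mean \o l') A = sum_on (portion_mean \o l) A.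
    by apply: eq_bigr => u _; apply: aE.
  rewrite /subtree_order eE.
  have -> : \sum_(A : {set H} | tree_set A) prod_on (portions \o l') A * sum_on (portion_mean \o l') A =
     \sum_(A : {set H} | tree_set A) prod_on (portions \o l) A * sum_on (portion_mean \o l) A + kap * M.
    rewrite /M mulr_sumr [X in _ + X]big_mkcondr -big_split; apply: eq_bigr => A _ /=.
    by rewrite prod_onE sum_onE; case: ifP => _; ring.
  by ring.
have Q0 : 0 < Q by apply: lt_le_trans Qge => /=; rewrite pE; nra.
pose c := M / Q; rewrite -/c in Tle.
have cM : M = c * Q by rewrite /c divfK // gt_eqF.
(* The lost subpaths have mean at most that of the gained subtrees. *)
have cm : 1 + (X + Y) / 2 <= c by apply: le_trans am _; rewrite ler_pdivlMr.
(* At least as many subtrees are gained as lost, since Q >= (X + 1) * (Y + 1). *)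
have kQ : d <= kap * Q.
  rewrite /kap mulrAC ler_pdivlMr; last by nra.
  rewrite ler_pM2l; last by lra.
  by apply: le_trans Qge => /=; rewrite pE ler_peMr //; nra.
have N0 := subtree_count_gt0 l; have N'0 := subtree_count_gt0 l'.
rewrite ler_pdivrMr // mulrAC ler_pdivlMr // countE orderE cM.
move: Tle kQ {N'0}; move: (subtree_order l) (subtree_count l) N0 => T N N0 TcN kQ.
have h1 : T * (kap * Q - d) <= c * N * (kap * Q - d) by apply: ler_wpM2r => //; lra.
have h2 : N * (d * (1 + (X + Y) / 2)) <= N * (d * c).
  by rewrite ler_pM2l // ler_pM2l //; lra.
nra.
Qed.

(** Each move lowers the sum of the squares of the limb orders, so that finitely many
    moves reach balanced lists; these agree with those of l' up to order. *)
Lemma balanced_optimal l l' :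
  (forall v, size (l v) = size (l' v)) -> (forall v, sumn (l v) = sumn (l' v)) ->
  (forall v, balanced (l' v)) ->
  subtree_order l / subtree_count l <= subtree_order l' / subtree_count l'.
Proof.
move=> + + bal'; have [n] := ubnP (\sum_v \sum_(x <- l v) x ^ 2)%N.
elim: n l => // n IHn l; rewrite ltnS => ln sz sm.
have [/forallP bal|/forallPn[v /unbalanced_split[y [k [s lv]]]]] :=
  boolP [forall v, balanced (l v)].
  have lp v : perm_eq (l v) (l' v) by apply: balanced_perm.
  have E1 v : portions (l v) = portions (l' v) by apply: portions_perm.
  have E2 v : portion_mean (l v) = portion_mean (l' v) by apply: portion_mean_perm.
  have E3 v : inner_count (l v) = inner_count (l' v) by apply: inner_count_perm.
  have E4 v : inner_order (l v) = inner_order (l' v) by apply: inner_order_perm.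
  have prod_onE (A : {set H}) : prod_on (portions \o l) A = prod_on (portions \o l') A.
    by apply: eq_bigr => v _; apply: E1.
  have sum_onE (A : {set H}) : sum_on (portion_mean \o l) A = sum_on (portion_mean \o l') A.
    by apply: eq_bigr => v _; apply: E2.
  rewrite /subtree_order /subtree_count (eq_bigr _ (fun v _ => E3 v)).
  rewrite (eq_bigr _ (fun v _ => E4 v)) (eq_bigr _ (fun A _ => prod_onE A)).
  rewrite (eq_bigr (fun A => prod_on (portions \o l') A * sum_on (portion_mean \o l') A)) //.
  by move=> A _; rewrite prod_onE sum_onE.
pose l1 u := if u == v then [:: (y + k.+1)%N, y.+1 & s] else l u.
have l1v : l1 v = [:: (y + k.+1)%N, y.+1 & s] by rewrite /l1 eqxx.
have l1E u : u != v -> l1 u = l u by rewrite /l1 => /negbTE->.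
apply: le_trans (IHn l1 _ _ _); first by apply: (balance_step lv); rewrite ?l1v.
- apply: leq_trans ln; rewrite (bigD1 v) //= [in leqRHS](bigD1 v) //= l1v.
  have rest : (\sum_(u | u != v) \sum_(x <- l1 u) x ^ 2 =
               \sum_(u | u != v) \sum_(x <- l u) x ^ 2)%N.
    by apply: eq_bigr => u /l1E->.
  rewrite rest ltn_add2r (perm_big _ lv) !big_cons /= !addnA ltn_add2r; nia.
- by move=> u; rewrite -sz /l1; case: eqP => // ->; rewrite (perm_size lv).
- move=> u; rewrite -sm /l1; case: eqP => // ->.
  by rewrite (perm_sumn lv) /=; lia.
Qed.

End Optimization.

(** * The mean subtree order in terms of the limb orders *)

Section Transport.
Variables (G G' : sgraph) (phi : G -> G').
Hypothesis phi_inj : injective phi.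
Hypothesis phi_mono : {mono phi : x y / edge x y}.

Lemma tree_set_imset (A : {set G}) : tree_set (phi @: A) = tree_set A.
Proof.
rewrite /tree_set /subtree /subgraph !subxx /=; congr (_ && _).
  apply/set0Pn/set0Pn => [[_ /imsetP[x xA _]]|[x xA]]; first by exists x.
  by exists (phi x); rewrite imset_f.
have E x y : subedge (phi @: A, edges_in (phi @: A)) (phi x) (phi y) =
             subedge (A, edges_in A) x y.
  by rewrite /subedge !pair_in_edges /= !mem_imset // phi_mono.
have C x y : connect (subedge (phi @: A, edges_in (phi @: A))) (phi x) (phi y) =
             connect (subedge (A, edges_in A)) x y.
  apply/connectP/connectP => [[p xp yE]|[p xp ->]].
    have [q qE] : exists q, p = map phi q.
      elim: p (phi x) xp {yE} => [|w p IHp] x' /=; first by exists [::].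
      case/andP=> + /IHp[q ->]; rewrite /subedge pair_in_edges => /and3P[_ /imsetP[w' _ ->] _].
      by exists (w' :: q).
    move: xp yE; rewrite qE last_map => xq /phi_inj yE; exists q => //.
    by elim: q x xq {qE p yE} => //= w q IHq x; rewrite E => /andP[-> /IHq].
  exists (map phi p); last by rewrite last_map.
  by elim: p x xp => //= w p IHp x /andP[xw /IHp]; rewrite E xw.
apply/forall_inP/forall_inP => H x xA; apply/forall_inP=> y yA.
  by rewrite -C; have /forall_inP := H (phi x) (imset_f _ xA); apply; apply: imset_f.
case/imsetP: xA yA => x' x'A -> /imsetP[y' y'A ->]; rewrite C.
by have /forall_inP := H x' x'A; apply.
Qed.

End Transport.

Definition limb_orders (T : sgraph) (x : T) : seq nat :=
  [seq #|L.1| | L : subgraph_data T <- enum (limbs_at x)].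

Lemma size_limb_orders (T : sgraph) (x : T) : size (limb_orders x) = limb_degree x.
Proof. by rewrite size_map -cardE. Qed.

Lemma sumn_limb_orders (T : sgraph) (x : T) : sumn (limb_orders x) = limb_weight x.
Proof. by rewrite sumnE big_map big_enum. Qed.

Lemma balanced_limb_orders (T : sgraph) (x : T) : balanced (limb_orders x) <->
  {in limbs_at x &, forall L L' : subgraph_data T, #|L.1| <= #|L'.1| + 1}.
Proof.
split=> [/balancedP bal L L' Lx L'x|bal].
  by apply: bal; apply/mapP; [exists L|exists L']; rewrite ?mem_enum.
by apply/balancedP=> _ _ /mapP[L + ->] /mapP[L' + ->]; rewrite !mem_enum; apply: bal.
Qed.

Section Formula.
Local Open Scope ring_scope.
Variables (H T : sgraph) (f : H -> core T).
Hypotheses (treeT : is_tree T) (notpath : ~~ is_path (whole T)) (isof : graph_iso f).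
Let phi v := val (f v).

Let phi_inj : injective phi.
Proof. by case: isof => /bij_inj finj _ x y /val_inj/finj. Qed.

Let phi_mono : {mono phi : x y / edge x y}.
Proof. by case: isof => _ m x y; rewrite -[LHS]/(edge (f x) (f y)) m. Qed.

Let phi_core : phi @: setT = core_set T.
Proof.
case: isof => -[g fK gK] _; apply/setP=> x; apply/imsetP/idP => [[v _ ->]|xc].
  exact: valP.
by exists (g (exist _ x xc)); rewrite // /phi gK.
Qed.

Definition lengths v := limb_orders (phi v).

Section Weights.
Variables (K : comNzRingType) (z : K).

Lemma sum_tree_sets_core :
  \sum_(A : {set T} | tree_set A) z ^+ #|A| =
  \sum_(A : {set H} | tree_set A)
     \prod_(v in A) (z * \prod_(l <- lengths v) (1 + runs z l)) +
  \sum_v \sum_(l <- lengths v) \sum_(i < l) runs z i.+1.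
Proof.
have [r r3] := not_path_branch treeT notpath.
have [R RE] := tree_rooting r treeT; rewrite -RE in r3.
have coreE := core_hairs r3; rewrite (sum_tree_sets r3).
have limbsE v : limbs_at (phi v) = hair R @: attached R (phi v).
  by apply: limbs_at_hair r3 _ _; rewrite -in_setC -coreE -phi_core imset_f.
rewrite -coreE -phi_core; congr (_ + _).
  rewrite (reindex_onto (fun A : {set H} => phi @: A) (fun S => phi @^-1: S)) /=.
    apply: eq_big => [A|A _].
      rewrite tree_set_imset // imsetS ?subsetT //= andb_idr // => _.
      by apply/eqP/setP=> v; rewrite inE mem_imset.
    rewrite big_imset /=; last by move=> x y _ _; apply: phi_inj.
    apply: eq_bigr => v _; congr (_ * _).
    rewrite big_map big_enum /= limbsE big_imset //= => x y _ _.
    exact: hair_inj.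
  move=> S /andP[/subsetP sub _]; apply/setP=> x; apply/imsetP/idP => [[v]|xS].
    by rewrite inE => ? ->.
  by have /imsetP[v _ xE] := sub x xS; exists v; rewrite // inE -xE.
rewrite big_imset /=; last by move=> x y _ _; apply: phi_inj.
apply: eq_big => [v|v _]; first by rewrite inE.
by rewrite big_map big_enum /= limbsE big_imset //= => x y _ _; apply: hair_inj.
Qed.

End Weights.

(** For the generating function of the subtrees by order, the value at 1 is their
    number and the derivative at 1 the sum of their orders. *)
Let jet (p : {poly rat}) (n s : rat) := p.[1] = n /\ p^`().[1] = s.

Let jetD p q n m s t : jet p n s -> jet q m t -> jet (p + q) (n + m) (s + t).
Proof. by move=> [<- <-] [<- <-]; rewrite /jet derivD !hornerD. Qed.

Let jetM p q n m s t : jet p n s -> jet q m t -> jet (p * q) (n * m) (s * m + n * t).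
Proof. by move=> [<- <-] [<- <-]; rewrite /jet derivM !hornerE. Qed.

Let jet_sum (I : Type) (r : seq I) (P : pred I) (g : I -> {poly rat}) (n s : I -> rat) :
  (forall i, P i -> jet (g i) (n i) (s i)) ->
  jet (\sum_(i <- r | P i) g i) (\sum_(i <- r | P i) n i) (\sum_(i <- r | P i) s i).
Proof.
move=> gi; apply: (big_ind3 (fun p n s => jet p n s)) => //.
  by rewrite /jet deriv0 !horner0.
by move=> *; apply: jetD.
Qed.

(** Logarithmic derivatives add up. *)
Let jet_prod (I : Type) (r : seq I) (P : pred I) (g : I -> {poly rat}) (n c : I -> rat) :
  (forall i, P i -> jet (g i) (n i) (n i * c i)) ->
  jet (\prod_(i <- r | P i) g i) (\prod_(i <- r | P i) n i)
      ((\prod_(i <- r | P i) n i) * \sum_(i <- r | P i) c i).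
Proof.
move=> gi; elim: r => [|i r IHr]; rewrite ?(big_nil, big_cons).
  by rewrite /jet mulr0 (derivC 1) !hornerE.
case: ifP => // Pi; have [h1 h2] := jetM (gi i Pi) IHr.
by split; rewrite ?h1 ?h2 //; ring.
Qed.

Let jetX : jet 'X 1 1.
Proof. by rewrite /jet derivX !hornerE. Qed.

Let succ1 n : n.+1%:R = n%:R + 1 :> rat.
Proof. by rewrite -addn1 natrD. Qed.

Let succ2 n : n.+2%:R = n%:R + 2 :> rat.
Proof. by rewrite -addn2 natrD. Qed.

Let succ3 n : n.+3%:R = n%:R + 3 :> rat.
Proof. by rewrite -addn3 natrD. Qed.

Let jet_runs n : jet (runs 'X n) n%:R (n%:R * n.+1%:R / 2).
Proof.
elim: n => [|n IHn]; first by rewrite /runs big_ord0 /jet deriv0 !horner0 !mul0r.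
rewrite runsS; have [h1 h2] := jetD jetX (jetM jetX IHn).
by split; rewrite ?h1 ?h2 (succ1 n) ?(succ2 n); field.
Qed.

Let jet_run1 n : jet (1 + runs 'X n) n.+1%:R (n.+1%:R * (n%:R / 2)).
Proof.
have jet1 : jet 1 1 0 by rewrite /jet (derivC 1) !hornerE.
by have [h1 h2] := jetD jet1 (jet_runs n); split; rewrite ?h1 ?h2 (succ1 n); ring.
Qed.

Let jet_inner n : jet (\sum_(i < n) runs 'X i.+1) (n%:R * n.+1%:R / 2)
  (n%:R * n.+1%:R * n.+2%:R / 6).
Proof.
elim: n => [|n IHn]; first by rewrite big_ord0 /jet deriv0 !horner0 !mul0r.
rewrite big_ord_recr /=; have [h1 h2] := jetD IHn (jet_runs n.+1).
by split; rewrite ?h1 ?h2 (succ1 n) (succ2 n) ?(succ3 n); field.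
Qed.

Lemma mean_order_formula :
  mean_subtree_order T = subtree_order lengths / subtree_count lengths.
Proof.
have sumS (F : nat -> nat) : (\sum_(S : subgraph_data T | subtree S) F #|S.1| =
    \sum_(A : {set T} | tree_set A) F #|A|)%N.
  have [r _] := not_path_branch treeT notpath; have [R _] := tree_rooting r treeT.
  rewrite (reindex_onto (fun A : {set T} => (A, edges_in A)) (fun S => S.1)) /=.
    by apply: eq_bigl => A; rewrite eqxx andbT.
  by move=> [A E]; rewrite (subtreeE R) /= => /andP[/eqP->].
have [cnt ordr] : jet (\sum_(A : {set T} | tree_set A) 'X ^+ #|A|)
    (subtree_count lengths) (subtree_order lengths).
  rewrite sum_tree_sets_core; apply: jetD; apply: jet_sum; last first.
    by move=> v _; apply: jet_sum => l _; apply: jet_inner.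
  move=> A _;   apply: jet_prod => v _ /=; rewrite /portion_mean mulrDr mulr1.
  have := jetM jetX (jet_prod (lengths v) (P := xpredT) (fun l _ => jet_run1 l)).
  by rewrite !mul1r.
rewrite /mean_subtree_order cardsE -sum1_card (sumS id) (sumS (fun=> 1%N)); congr (_ / _).
  rewrite -ordr (big_morph _ (@derivD _) (@deriv0 _)) horner_sum natr_sum; apply: eq_bigr => A _.
  by rewrite derivXn hornerMn hornerXn expr1n.
rewrite -cnt horner_sum natr_sum; apply: eq_bigr => A _.
by rewrite hornerXn expr1n.
Qed.

End Formula.

(** * Existence of a locally balanced tree *)

Section Realized.
Variables (H T : sgraph) (f : H -> core T).
Hypotheses (treeT : is_tree T) (notpath : ~~ is_path (whole T)) (isof : graph_iso f).
Let phi v := val (f v).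

Lemma limb_degree_le_weight v : limb_degree (phi v) <= limb_weight (phi v).
Proof.
rewrite /limb_degree /limb_weight -sum1_card; apply: leq_sum => L.
rewrite inE => /andP[/andP[/and3P[_ /exists_inP[x xL _] _] _] _].
by apply/card_gt0P; exists x.
Qed.

Lemma limb_weight_gt0 v : 0 < limb_weight (phi v) -> 0 < limb_degree (phi v).
Proof.
rewrite !lt0n; apply: contraNneq => /eqP; rewrite cards_eq0 => /eqP E.
by rewrite /limb_weight E big_set0.
Qed.

(** The neighbours of a core vertex outside the core are the ends of its limbs. *)
Lemma core_degree v : degree (phi v) = degree v + limb_degree (phi v).
Proof.
have [r r3] := not_path_branch treeT notpath.
have [R RE] := tree_rooting r treeT; rewrite -RE in r3.
have coreE := core_hairs r3.
have phi_inj : injective phi.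
  by case: isof => /bij_inj finj _ x y /val_inj/finj.
have phi_mono x y : edge (phi x) (phi y) = edge x y.
  by case: isof => _ m; rewrite -[LHS]/(edge (f x) (f y)) m.
have vN : phi v \notin hairs R by rewrite -in_setC -coreE; apply: valP.
rewrite /limb_degree (limbs_at_hair r3 vN) card_imset; last exact: hair_inj.
rewrite /degree -(card_imset _ phi_inj) -cardsUI.
rewrite [X in _ = _ + X](_ : _ = 0) ?addn0; last first.
  apply/eqP; rewrite cards_eq0 -subset0; apply/subsetP=> y.
  rewrite in_setI => /andP[/imsetP[u _ ->]]; rewrite in_set => /andP[/andP[uU _] _].
  have : phi u \in core_set T by apply: valP.
  by rewrite coreE in_setC uU.
apply: eq_card => y; rewrite in_set in_setU.
have [yU|yN] := boolP (y \in hairs R).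
  rewrite [in RHS]orbC edge_sym (edge_hairs r3 yU vN) [y \in attached _ _]in_set /hairtop yU.
  case: eqP => [->|_]; rewrite ?vN ?andbF //=.
  apply/esym/imsetP => [[u _ yE]]; have : phi u \in core_set T by apply: valP.
  by rewrite coreE in_setC -yE yU.
rewrite [y \in attached _ _]in_set /hairtop (negbTE yN) orbF.
have [g fK gK] : bijective f by case: isof.
have yc : y \in core_set T by rewrite coreE in_setC.
have yE : y = phi (g (exist _ y yc)) by rewrite /phi gK.
by rewrite yE mem_imset // in_set phi_mono.
Qed.

Lemma limb_degree_gt0 v : 0 < limb_degree (phi v) -> 2 < degree v + limb_degree (phi v).
Proof.
have [r r3] := not_path_branch treeT notpath.
have [R RE] := tree_rooting r treeT; rewrite -RE in r3.
have vN : phi v \notin hairs R by rewrite -in_setC -(core_hairs r3); apply: valP.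
rewrite -core_degree /limb_degree (limbs_at_hair r3 vN).
case/card_gt0P=> _ /imsetP[x + _]; rewrite in_set => /andP[xt /eqP<-].
exact: degree_attach.
Qed.

Lemma limb_degree_eq0 v : limb_degree (phi v) = 0 -> 1 < degree v.
Proof.
move=> d0; have := core_degree v; rewrite d0 addn0 => <-.
have [r r3] := not_path_branch treeT notpath.
have [R RE] := tree_rooting r treeT; rewrite -RE in r3.
have vN : phi v \notin hairs R by rewrite -in_setC -(core_hairs r3); apply: valP.
have [->|vr] := eqVneq (phi v) (base R); first exact: ltnW.
rewrite (degree_parent R) vr ltnS lt0n cards_eq0; apply: contra vN => /eqP c0.
by apply: hairs_step => [|c]; rewrite c0 ?cards0 ?in_set0.
Qed.

Lemma core_branch : exists v, 2 < degree v + limb_degree (phi v).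
Proof.
have [r r3] := not_path_branch treeT notpath.
have [R RE] := tree_rooting r treeT; rewrite -RE in r3.
have rc : base R \in core_set T by rewrite (core_hairs r3) in_setC base_notin_hairs.
have [g fK gK] : bijective f by case: isof.
by exists (g (exist _ (base R) rc)); rewrite -core_degree /phi gK.
Qed.

End Realized.

Section ParentGraph.
Variables (V : finType) (r : V) (par : V -> V) (rk : V -> nat).
Hypothesis par_base : par r = r.
Hypothesis rk_par : forall x, x != r -> rk (par x) < rk x.

Definition parent_edge : rel V := fun x y =>
  ((x != r) && (par x == y)) || ((y != r) && (par y == x)).

Lemma parent_edge_sym : symmetric parent_edge.
Proof. by move=> x y; rewrite /parent_edge orbC. Qed.

Lemma parent_edge_irr : irreflexive parent_edge.
Proof.
move=> x; rewrite /parent_edge orbb; apply/negP=> /andP[/rk_par + /eqP E].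
by rewrite E ltnn.
Qed.

Definition parent_graph : sgraph := SGraph parent_edge_sym parent_edge_irr.

Definition parent_rooting : rooting parent_graph :=
  @Rooting parent_graph r par rk par_base rk_par (fun x y => erefl).

End ParentGraph.

(** Shifting k to k - d + j - i injects the class of i, without its least element,
    into the class of j. *)
Lemma residue_class_balanced w d i j : i < d -> j < d ->
  #|[set k : 'I_w | k %% d == i]| <= #|[set k : 'I_w | k %% d == j]| + 1.
Proof.
move=> id jd; rewrite -(cardsID [set k : 'I_w | d <= k]) leq_add //.
  have sub_lt (k : 'I_w) : k - (d + i - j) < w by apply: leq_ltn_trans (leq_subr _ _) (ltn_ord k).
  have inj : {in [set k : 'I_w | k %% d == i] :&: [set k : 'I_w | d <= k] &,
               injective (fun k => Ordinal (sub_lt k))}.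
    move=> k k'; rewrite !inE => /andP[/eqP ki dk] /andP[/eqP k'i dk'] [E].
    apply: val_inj => /=; move: E (divn_eq k d) (divn_eq k' d); rewrite ki k'i.
    move: (k %/ d) (k' %/ d) => q q' E Ek Ek'.
    have q0 : 0 < q by case: q Ek => //; lia.
    have q'0 : 0 < q' by case: q' Ek' => //; lia.
    have : d <= q * d by rewrite leq_pmull.
    have : d <= q' * d by rewrite leq_pmull.
    lia.
  rewrite -(card_in_imset inj); apply/subset_leq_card/subsetP=> _ /imsetP[k + ->].
  rewrite !inE => /andP[/eqP ki dk] /=; move: (divn_eq k d); rewrite ki.
  case: (k %/ d) => [|q] E; first by lia.
  have -> : k - (d + i - j) = q * d + j by rewrite E mulSn; lia.
  by rewrite modnMDl modn_small.
apply/card_le1_eqP=> k k'; rewrite !inE -!ltnNge => /andP[kd /eqP ki] /andP[k'd /eqP k'i].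
by apply: val_inj; rewrite /= -(modn_small kd) -(modn_small k'd) ki k'i.
Qed.

(** A tree with prescribed limb degrees d and limb weights w over the core H. The
    degree hypotheses say that no vertex of H falls into a limb. *)
Section Model.
Variables (H : sgraph) (treeH : is_tree H) (w d : H -> nat).
Hypothesis d_le_w : forall v, d v <= w v.
Hypothesis d_gt0 : forall v, 0 < w v -> 0 < d v.
Hypothesis deg_limbs : forall v, 0 < d v -> 2 < degree v + d v.
Hypothesis deg_nolimb : forall v, d v = 0 -> 1 < degree v.
Variable RH : rooting H.

Let V : finType := (H + {v : H & 'I_(w v)})%type.
Let limb_vertex v (k : 'I_(w v)) : V := inr (Tagged (fun v => 'I_(w v)) k).

Let sub_lt v (k : 'I_(w v)) : k - d v < w v.
Proof. exact: leq_ltn_trans (leq_subr _ _) (ltn_ord k). Qed.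

(** Limb vertex k over v hangs below limb vertex k - d v, or below v if k < d v. *)
Definition limb_parent (x : V) : V :=
  match x with
  | inl v => inl (parent RH v)
  | inr t => if tagged t < d (tag t) then inl (tag t) else limb_vertex (Ordinal (sub_lt (tagged t)))
  end.

Definition limb_rank (x : V) : nat :=
  match x with
  | inl v => rank RH v
  | inr t => rank RH (tag t) + tagged t + 1
  end.

Let limb_parent_base : limb_parent (inl (base RH)) = inl (base RH).
Proof. by rewrite /= parent_base. Qed.

Let limb_rank_parent x : x != inl (base RH) -> limb_rank (limb_parent x) < limb_rank x.
Proof.
case: x => [v vr|[v k] _] /=; first exact: rank_parent.
have := d_gt0 (leq_ltn_trans (leq0n _) (ltn_ord k)).
by have [kd|dk] := ltnP k (d v) => /=; lia.
Qed.

Definition balanced_tree : sgraph := parent_graph limb_rank_parent.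
Let R : rooting balanced_tree := parent_rooting limb_parent_base limb_rank_parent.
Hypothesis deg_base : 2 < degree (base RH) + d (base RH).

Let limb_vertex_inj v : injective (@limb_vertex v).
Proof. by move=> k k' []; apply: eq_from_Tagged. Qed.

Let mem_children_core v x : (x \in children R (inl v)) =
  match x with inl u => u \in children RH v | inr t => (tag t == v) && (tagged t < d (tag t)) end.
Proof.
rewrite in_set; case: x => [u|[u k]] /=; first by rewrite in_set.
by case: ltnP => _; rewrite ?andbT ?andbF.
Qed.

Let card_children_core v : #|children R (inl v)| = #|children RH v| + d v.
Proof.
have -> : children R (inl v) = (@inl H _ @: children RH v : {set V}) :|:
    (@limb_vertex v @: [set k : 'I_(w v) | k < d v]).
  apply/setP=> x; apply/idP/setUP => [|[/imsetP[u uv ->]|/imsetP[k kd ->]]].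
  - rewrite mem_children_core; case: x => [u uv|[u k] /= /andP[/eqP uv]].
      by left; apply: imset_f.
    by move: uv k => -> k kd; right; apply: imset_f; rewrite inE.
  - by rewrite mem_children_core.
  - by rewrite mem_children_core /= eqxx; move: kd; rewrite inE.
rewrite cardsU (_ : _ :&: _ = set0) ?cards0 ?subn0; last first.
  apply/setP=> x; rewrite in_setI in_set0; apply/andP=> -[/imsetP[u _ ->]].
  by case/imsetP.
rewrite card_imset; last by move=> ? ? [].
rewrite card_imset; last exact: limb_vertex_inj.
congr (_ + _); rewrite -sum1_card -[RHS]card_ord -sum1_card.
rewrite (big_ord_widen _ (fun=> 1) (d_le_w v)) /=.
by apply: eq_bigl => k; rewrite inE.
Qed.

Let core_balanced_tree_degree v : degree (inl v : balanced_tree) = degree v + d v.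
Proof.
rewrite (degree_parent R) card_children_core (degree_parent RH) addnA.
by congr (_ + _ + _); congr nat_of_bool.
Qed.

Let deg3 : 2 < degree (base R).
Proof. by rewrite core_balanced_tree_degree. Qed.

Let desc_limb_vertex_core x v (k : 'I_(w v)) u : x \in desc R (limb_vertex k) -> x <> inl u.
Proof.
elim/(rank_ind (R := R)): x u => x IH u xk xu.
have [xr|xr] := eqVneq x (base R).
  by move: xk; rewrite xr => /desc_of_base.
apply: (IH xr (parent RH u)); last by rewrite xu.
by apply: desc_up => //; rewrite xu.
Qed.

Let child_limb_vertex v (k : 'I_(w v)) x : x \in children R (limb_vertex k) ->
  exists2 k' : 'I_(w v), x = limb_vertex k' & k' = k + d v :> nat.
Proof.
rewrite in_set; case: x => [u|[u k'] /=]; first by rewrite andbF.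
case: ltnP => // dk /eqP [] uv; move: uv k' dk => -> k' dk /eqP.
rewrite eq_Tagged /= => /eqP <-; exists k' => //=; by rewrite subnK.
Qed.

Let limb_vertex_hairs v (k : 'I_(w v)) : limb_vertex k \in hairs R.
Proof.
apply/hairsP=> x xk; case: x xk => [u /desc_limb_vertex_core/(_ erefl)//|[u k'] _].
apply/card_le1_eqP=> y y' /child_limb_vertex[j -> jE] /child_limb_vertex[j' -> j'E].
by congr (limb_vertex _); apply: val_inj; rewrite /= jE j'E.
Qed.

(** A core vertex with a limb has two children because its degree is at least 3; one
    without limbs, if not the base, has a child in the core, and hence, by
    induction on the branch, two children somewhere below it. *)
Let inl_core v : inl v \notin hairs R.
Proof.
have [n] := ubnP #|desc RH v|; elim: n v => // n IHn v; rewrite ltnS => vn.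
have [->|vr] := eqVneq v (base RH); first exact: (base_notin_hairs deg3).
have [d0|d1] := posnP (d v).
  have := deg_nolimb d0; rewrite (degree_parent RH) vr ltnS => /card_gt0P[c cv].
  have cN : inl c \notin hairs R.
    by apply: IHn; apply: leq_trans vn; apply/proper_card/desc_child_proper.
  apply: contra cN => /hairs_desc; apply; apply: desc_child.
  by rewrite mem_children_core.
apply/negP=> /hairsP/(_ _ (desc_refl R _)); rewrite card_children_core leqNgt.
by have := deg_limbs d1; rewrite (degree_parent RH) vr add1n addSn ltnS => ->.
Qed.

Let balanced_tree_core : core_set balanced_tree = [set x | if x is inl _ then true else false].
Proof.
rewrite (core_hairs deg3); apply/setP=> -[v|[v k]]; rewrite in_setC [RHS]in_set.
  by rewrite inl_core.
by rewrite (limb_vertex_hairs k).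
Qed.

Let inl_core_set v : (inl v : balanced_tree) \in core_set balanced_tree.
Proof. by rewrite balanced_tree_core inE. Qed.

Definition balanced_tree_core_map (v : H) : core balanced_tree := exist _ (inl v : balanced_tree) (inl_core_set v).

Lemma balanced_tree_tree : is_tree balanced_tree.
Proof. exact: rooting_tree R. Qed.

Lemma balanced_tree_not_path : ~~ is_path (whole balanced_tree).
Proof. by apply/negP=> /(path_degree (base R)); rewrite leqNgt deg3. Qed.

Lemma balanced_tree_core_iso : graph_iso balanced_tree_core_map.
Proof.
split; last first.
  move=> u v; rewrite -[LHS]/(edge (inl u : balanced_tree) (inl v)) (edge_parent R) (edge_parent RH).
  by [].
have inl_of (x : core balanced_tree) : {v | val x = inl v}.
  case: x => -[v|t] xc /=; first by exists v.
  by move: (xc); rewrite balanced_tree_core inE.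
exists (fun x => sval (inl_of x)) => [v|x].
  by case: (inl_of _) => u /= [].
by apply: val_inj; case: (inl_of _) => u /= ->.
Qed.

Let attachedE v : attached R (inl v) = @limb_vertex v @: [set k : 'I_(w v) | k < d v].
Proof.
apply/setP=> x; rewrite in_set; apply/andP/imsetP => [[/andP[xU pN] /eqP px]|[k kd ->]].
  case: x xU px {pN} => [u|[u k] _ /=]; first by rewrite (negbTE (inl_core u)).
  case: ltnP => // kd [uv]; move: uv k kd => -> k kd.
  by exists k; rewrite ?inE.
have px : parent R (limb_vertex k) = inl v by rewrite /=; move: kd; rewrite inE => ->.
by rewrite /hairtop px eqxx limb_vertex_hairs inl_core.
Qed.

(** Each step towards the core subtracts d v, so a limb is a residue class modulo
    d v. *)
Let desc_limb_vertex v (k i : 'I_(w v)) : i < d v -> (limb_vertex k \in desc R (limb_vertex i)) = (k %% d v == i).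
Proof.
move=> id.
have top (j : 'I_(w v)) : j < d v -> hairtop R (limb_vertex j).
  move=> jd; have : limb_vertex j \in attached R (inl v) by rewrite attachedE imset_f // inE.
  by rewrite in_set => /andP[].
have mod_lt : k %% d v < w v by apply: leq_ltn_trans (leq_mod _ _) (ltn_ord k).
have d0 : 0 < d v by apply: leq_ltn_trans id.
have down (j : 'I_(w v)) : j = k %% d v :> nat -> limb_vertex k \in desc R (limb_vertex j).
  have [n] := ubnP k; elim: n k {mod_lt} => // n IHn k'; rewrite ltnS => kn jE.
  have [k'd|dk'] := ltnP k' (d v).
    have -> : k' = j by apply: ord_inj; rewrite jE modn_small.
    exact: desc_refl.
  apply: desc_down; rewrite /= ltnNge dk' /=; apply: IHn => /=; first by lia.
  by rewrite jE -{1}(subnK dk') modnDr.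
apply/idP/eqP => [ki|E]; last by apply: down.
have E := hairtop_uniq (top i id) (top (Ordinal mod_lt) (ltn_pmod _ d0)) ki
  (down (Ordinal mod_lt) erefl).
by have := limb_vertex_inj E => ->.
Qed.

Let card_desc_limb_vertex v (i : 'I_(w v)) : i < d v ->
  #|desc R (limb_vertex i)| = #|[set k : 'I_(w v) | k %% d v == i]|.
Proof.
move=> id; rewrite -(card_imset _ (@limb_vertex_inj v)); apply: eq_card => x.
apply/idP/imsetP => [|[k + ->]]; last by rewrite inE desc_limb_vertex.
case: x => [u /desc_limb_vertex_core/(_ erefl)//|[u k] xi].
have uv : u = v.
  move: xi; have [n] := ubnP k; elim: n k => // n IHn k; rewrite ltnS => kn xi.
  have [|ne] := eqVneq (inr (Tagged (fun v0 => 'I_(w v0)) k) : V) (limb_vertex i); first by case.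
  have /= := desc_up xi ne; case: ltnP => [_ /desc_limb_vertex_core/(_ erefl)//|dk].
  apply: IHn => /=; apply: leq_trans kn; have := d_gt0 (leq_ltn_trans (leq0n _) (ltn_ord k)).
  by lia.
move: uv k xi => -> k xi; exists k => //; by rewrite inE -desc_limb_vertex.
Qed.

Let limbs_balanced_tree v : limbs_at (inl v : balanced_tree) = hair R @: attached R (inl v).
Proof. exact: (limbs_at_hair deg3 (inl_core v)). Qed.

Lemma balanced_tree_limb_degree v : limb_degree (inl v : balanced_tree) = d v.
Proof.
rewrite /limb_degree limbs_balanced_tree card_imset; last exact: hair_inj.
rewrite attachedE card_imset; last exact: limb_vertex_inj.
rewrite -sum1_card -[RHS]card_ord -sum1_card (big_ord_widen _ (fun=> 1) (d_le_w v)).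
by apply: eq_bigl => k; rewrite inE.
Qed.

Lemma balanced_tree_limb_weight v : limb_weight (inl v : balanced_tree) = w v.
Proof.
rewrite /limb_weight limbs_balanced_tree big_imset /=; last by apply: in2W; exact: (@hair_inj _ R).
rewrite attachedE big_imset /=; last by apply: in2W; apply: limb_vertex_inj.
rewrite (eq_bigr (fun i : 'I_(w v) => #|[set k : 'I_(w v) | k %% d v == i]|)); last first.
  by move=> i; rewrite inE; apply: card_desc_limb_vertex.
rewrite -[RHS]card_ord -sum1_card.
have mod_lt (k : 'I_(w v)) : k %% d v < w v.
  exact: leq_ltn_trans (leq_mod _ _) (ltn_ord k).
rewrite [RHS](partition_big (fun k => Ordinal (mod_lt k)) (mem [set k : 'I_(w v) | k < d v])) /=.
  apply: eq_bigr => i _; rewrite -sum1_card; apply: eq_bigl => k.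
  by rewrite inE -val_eqE.
move=> k _; rewrite inE /= ltn_pmod //.
exact: d_gt0 (leq_ltn_trans (leq0n _) (ltn_ord k)).
Qed.

Lemma balanced_tree_balanced : locally_balanced balanced_tree.
Proof.
move=> x; rewrite balanced_tree_core inE; case: x => // v _ L L'.
rewrite limbs_balanced_tree attachedE => /imsetP[_ /imsetP[i + ->] ->] /imsetP[_ /imsetP[j + ->] ->].
rewrite !inE => id jd; rewrite /= !card_desc_limb_vertex //.
exact: residue_class_balanced.
Qed.

End Model.

(** * The optimality theorem *)

Theorem theorem3p5 (H : sgraph) (theta : seq H) (Lambda Delta : seq nat)
    (treeH : is_tree H)
    (ordering : perm_eq theta (enum H))
    (realized : exists T : sgraph, limb_family theta Lambda Delta T) :
  (exists T : sgraph,
     limb_family theta Lambda Delta T /\ locally_balanced T) /\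
  (forall T : sgraph,
     limb_family theta Lambda Delta T -> locally_balanced T ->
     optimal_in (limb_family theta Lambda Delta) T).
Proof.
have thetaP (g g' : H -> nat) : [seq g v | v <- theta] = [seq g' v | v <- theta] -> g =1 g'.
  by move=> /eq_in_map gg' v; apply: gg'; rewrite (perm_mem ordering) mem_enum.
split.
  have [T [treeT nP [f [isof <- <-]]]] := realized.
  have [r r3] := core_branch treeT nP isof.
  have [RH RE] := tree_rooting r treeH; rewrite -RE in r3.
  have dw := limb_degree_le_weight f; have d0 := @limb_weight_gt0 _ _ f.
  have dl := limb_degree_gt0 treeT nP isof; have dn := limb_degree_eq0 treeT nP isof.
  exists (balanced_tree d0 RH); split; last exact: (balanced_tree_balanced dw dl dn r3).
  split; [exact: balanced_tree_tree|exact: (balanced_tree_not_path dw d0 r3)|].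
  exists (balanced_tree_core_map dw d0 dl dn r3); split; first exact: balanced_tree_core_iso.
    by apply: eq_map => v; apply: (balanced_tree_limb_weight dw d0 dl dn r3).
  by apply: eq_map => v; apply: (balanced_tree_limb_degree dw d0 dl dn r3).
move=> T famT balT; split=> // T' [treeT' nP' [f' [iso' wt' deg']]].
have [treeT nP [f [isof wtT degT]]] := famT.
rewrite (mean_order_formula treeT' nP' iso') (mean_order_formula treeT nP isof).
apply: balanced_optimal => // v.
- by rewrite !size_limb_orders; exact: thetaP (etrans deg' (esym degT)) v.
- by rewrite !sumn_limb_orders; exact: thetaP (etrans wt' (esym wtT)) v.
- by apply/balanced_limb_orders/balT; apply: valP.
Qed.
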